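(* Over $\mathsf{RCA}_0$, the following statements are pairwise equivalent: (1) $\mathsf{ACA}_0$ (arithmetical comprehension); (2) every partial order with no arbitrarily large finite strong antichains is a finite union of ideals; (3) every partial order with no infinite strong antichains does not contain arbitrarily large finite strong antichains; (4) every partial order with no infinite strong antichains is a finite union of ideals; (5) if a partial order has no infinite antichains, then every initial interval of it is a finite union of ideals; (6) every well-partial order is a finite union of ideals.
   Context: This is a statement of reverse mathematics in second-order arithmetic; $\mathsf{RCA}_0$ and $\mathsf{ACA}_0$ are the usual subsystems. A partial order $(P,\preceq)$ has $P\subseteq\mathbb{N}$ and $\preceq\subseteq P\times P$ reflexive, antisymmetric, transitive. $x,y$ are incomparable if neither $x\preceq y$ nor $y\preceq x$; an antichain is a set of pairwise incomparable elements. $x,y\in P$ are compatible in $X\subseteq P$ if there is $z\in X$ with $x\preceq z$ and $y\preceq z$. A strong antichain in $P$ is a set $S\subseteq P$ such that for all $x,y\in S$ and $z\in P$, $x,y\preceq z$ implies $x=y$. ''No arbitrarily large finite strong antichains'' means there is $k\in\mathbb{N}$ bounding the size of every finite strong antichain. An initial interval of $P$ is $I\subseteq P$ with $x\preceq y\in I\Rightarrow x\in I$. An ideal is an initial interval $A$ any two of whose elements are compatible in $A$. A well-partial order is a partial order $P$ such that for every $f:\mathbb{N}\to P$ there are $i<j$ with $f(i)\preceq f(j)$. *)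

(* Defs.v *)
From Stdlib Require Import List.

(** * The language of second-order arithmetic and its structures *)

(** Structures are the general (Henkin) ones: set variables range over the
    second sort [sets], which need not contain all subsets of [num].  Equality
    is primitive for numbers only. *)
Record L2structure : Type := {
  num  : Type;
  sets : Type;
  mem  : sets -> num -> Prop;
  zero : num;
  one  : num;
  add  : num -> num -> num;
  mul  : num -> num -> num;
  lt   : num -> num -> Prop;
  sets_inhabited : inhabited sets
}.

Arguments mem {_} _ _.
Arguments zero {_}.
Arguments one {_}.
Arguments add {_} _ _.
Arguments mul {_} _ _.
Arguments lt {_} _ _.

Declare Scope L2_scope.
Delimit Scope L2_scope with L2.
Local Open Scope L2_scope.

Notation "0" := zero : L2_scope.
Notation "1" := one : L2_scope.
Notation "m + n" := (add m n) : L2_scope.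
Notation "m * n" := (mul m n) : L2_scope.
Notation "m < n" := (lt m n) : L2_scope.
Notation "n 'isin' X" := (mem X n) (at level 70, no associativity) : L2_scope.

(** De Bruijn indices, with separate index spaces for number and set
    variables. *)
Inductive term : Type :=
| TVar (i : nat)
| TZero
| TOne
| TAdd (t u : term)
| TMul (t u : term).

Inductive formula : Type :=
| FEq (t u : term)
| FLt (t u : term)
| FIn (t : term) (X : nat)
| FNot (f : formula)
| FAnd (f g : formula)
| FOr (f g : formula)
| FImp (f g : formula)
| FAllN (f : formula)
| FExN (f : formula)
| FAllS (f : formula)
| FExS (f : formula).

Definition scons {A : Type} (a : A) (e : nat -> A) (i : nat) : A :=
  match i with O => a | S j => e j end.

Fixpoint eval {M : L2structure} (e : nat -> num M) (t : term) : num M :=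
  match t with
  | TVar i => e i
  | TZero => 0
  | TOne => 1
  | TAdd t u => eval e t + eval e u
  | TMul t u => eval e t * eval e u
  end.

Fixpoint sat {M : L2structure} (e : nat -> num M) (E : nat -> sets M)
    (f : formula) : Prop :=
  match f with
  | FEq t u => eval e t = eval e u
  | FLt t u => eval e t < eval e u
  | FIn t X => eval e t isin E X
  | FNot f => ~ sat e E f
  | FAnd f g => sat e E f /\ sat e E g
  | FOr f g => sat e E f \/ sat e E g
  | FImp f g => sat e E f -> sat e E g
  | FAllN f => forall n, sat (scons n e) E f
  | FExN f => exists n, sat (scons n e) E f
  | FAllS f => forall X, sat e (scons X E) f
  | FExS f => exists X, sat e (scons X E) f
  end.

Fixpoint lift (t : term) : term :=
  match t with
  | TVar i => TVar (S i)
  | TZero => TZero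
  | TOne => TOne
  | TAdd t u => TAdd (lift t) (lift u)
  | TMul t u => TMul (lift t) (lift u)
  end.

(** Bounded-quantifier formulas.  [lift] expresses that the bound [t] does not
    contain the quantified variable. *)
Inductive bounded : formula -> Prop :=
| bounded_eq t u : bounded (FEq t u)
| bounded_lt t u : bounded (FLt t u)
| bounded_in t X : bounded (FIn t X)
| bounded_not f : bounded f -> bounded (FNot f)
| bounded_and f g : bounded f -> bounded g -> bounded (FAnd f g)
| bounded_or f g : bounded f -> bounded g -> bounded (FOr f g)
| bounded_imp f g : bounded f -> bounded g -> bounded (FImp f g)
| bounded_all t f :
    bounded f -> bounded (FAllN (FImp (FLt (TVar O) (lift t)) f))
| bounded_ex t f :
    bounded f -> bounded (FExN (FAnd (FLt (TVar O) (lift t)) f)).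

Inductive Sigma01 : formula -> Prop :=
| Sigma01_intro f : bounded f -> Sigma01 (FExN f).

Inductive Pi01 : formula -> Prop :=
| Pi01_intro f : bounded f -> Pi01 (FAllN f).

(** No set quantifiers; free set variables are allowed. *)
Fixpoint arithmetical (f : formula) : Prop :=
  match f with
  | FEq _ _ | FLt _ _ | FIn _ _ => True
  | FNot f | FAllN f | FExN f => arithmetical f
  | FAnd f g | FOr f g | FImp f g => arithmetical f /\ arithmetical g
  | FAllS _ | FExS _ => False
  end.

(** * The systems RCA_0 and ACA_0

    In the schemes the distinguished number variable has index [O]; all other
    variables are parameters, interpreted by [e] and [E]. *)

Record basic_axioms (M : L2structure) : Prop := {
  succ_neq0 : forall n : num M, n + 1 <> 0;
  succ_inj  : forall m n : num M, m + 1 = n + 1 -> m = n;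
  add_0     : forall m : num M, m + 0 = m;
  add_succ  : forall m n : num M, m + (n + 1) = (m + n) + 1;
  mul_0     : forall m : num M, m * 0 = 0;
  mul_succ  : forall m n : num M, m * (n + 1) = m * n + m;
  nlt_0     : forall m : num M, ~ m < 0;
  lt_succ   : forall m n : num M, m < n + 1 <-> m < n \/ m = n
}.

Definition Sigma01_induction (M : L2structure) : Prop :=
  forall f, Sigma01 f -> forall (e : nat -> num M) (E : nat -> sets M),
    sat (scons 0 e) E f ->
    (forall n, sat (scons n e) E f -> sat (scons (n + 1) e) E f) ->
    forall n, sat (scons n e) E f.

Definition Delta01_comprehension (M : L2structure) : Prop :=
  forall f g, Sigma01 f -> Pi01 g ->
  forall (e : nat -> num M) (E : nat -> sets M),
    (forall n, sat (scons n e) E f <-> sat (scons n e) E g) ->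
    exists X : sets M, forall n, n isin X <-> sat (scons n e) E f.

Definition set_induction (M : L2structure) : Prop :=
  forall X : sets M,
    0 isin X -> (forall n, n isin X -> n + 1 isin X) -> forall n, n isin X.

Definition arithmetical_comprehension (M : L2structure) : Prop :=
  forall f, arithmetical f -> forall (e : nat -> num M) (E : nat -> sets M),
    exists X : sets M, forall n, n isin X <-> sat (scons n e) E f.

Definition RCA0 (M : L2structure) : Prop :=
  basic_axioms M /\ Sigma01_induction M /\ Delta01_comprehension M.

Definition ACA0 (M : L2structure) : Prop :=
  basic_axioms M /\ set_induction M /\ arithmetical_comprehension M.

(** * Coding inside a structure

    What follows is the satisfaction in [M] of the corresponding formulas of
    second-order arithmetic: all quantifiers range over [num M] or [sets M].
    An argument of type [num M -> Prop] only ever receives a set of [M], or a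
    class which is computable in one and so is a set when [M] satisfies
    RCA_0. *)

Definition pair {M : L2structure} (m n : num M) : num M :=
  (m + n) * (m + n) + m.

Definition le {M : L2structure} (m n : num M) : Prop := m < n \/ m = n.

Definition finite {M : L2structure} (X : sets M) : Prop :=
  exists k, forall i, i isin X -> i < k.

Definition infinite {M : L2structure} (X : sets M) : Prop := ~ finite X.

Definition subset_prod {M : L2structure} (F : sets M) (X Y : num M -> Prop) :
    Prop :=
  forall p, p isin F -> exists x y, X x /\ Y y /\ p = pair x y.

Definition is_function {M : L2structure} (F : sets M) (X Y : num M -> Prop) :
    Prop :=
  subset_prod F X Y /\ forall x, X x -> exists! y, pair x y isin F.

Definition is_bijection {M : L2structure} (F : sets M) (X Y : num M -> Prop) :
    Prop :=
  is_function F X Y /\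
  (forall x x' y, pair x y isin F -> pair x' y isin F -> x = x') /\
  (forall y, Y y -> exists x, pair x y isin F).

Definition has_size {M : L2structure} (X : sets M) (n : num M) : Prop :=
  exists F, is_bijection F (fun i => i < n) (mem X).

(** The [i]-th term of the sequence of sets coded by [A]. *)
Definition section {M : L2structure} (A : sets M) (i : num M) :
    num M -> Prop :=
  fun x => pair x i isin A.

(** * Partial orders

    [P] is the field and [R] the set of pairs coding the order relation. *)

Definition partial_order {M : L2structure} (P R : sets M) : Prop :=
  subset_prod R (mem P) (mem P) /\
  (forall x, x isin P -> pair x x isin R) /\
  (forall x y, pair x y isin R -> pair y x isin R -> x = y) /\
  (forall x y z, pair x y isin R -> pair y z isin R -> pair x z isin R).

Definition incomparable {M : L2structure} (R : sets M) (x y : num M) : Prop :=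
  ~ pair x y isin R /\ ~ pair y x isin R.

Definition antichain {M : L2structure} (P R X : sets M) : Prop :=
  (forall x, x isin X -> x isin P) /\
  (forall x y, x isin X -> y isin X -> x <> y -> incomparable R x y).

Definition compatible_in {M : L2structure} (R : sets M) (X : num M -> Prop)
    (x y : num M) : Prop :=
  exists z, X z /\ pair x z isin R /\ pair y z isin R.

Definition strong_antichain {M : L2structure} (P R X : sets M) : Prop :=
  (forall x, x isin X -> x isin P) /\
  (forall x y z, x isin X -> y isin X -> z isin P ->
     pair x z isin R -> pair y z isin R -> x = y).

Definition initial_interval {M : L2structure} (P R : sets M)
    (X : num M -> Prop) : Prop :=
  (forall x, X x -> x isin P) /\
  (forall x y, pair x y isin R -> X y -> X x).

Definition ideal {M : L2structure} (P R : sets M) (X : num M -> Prop) : Prop :=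
  initial_interval P R X /\
  (forall x y, X x -> X y -> compatible_in R X x y).

Definition finite_union_of_ideals {M : L2structure} (P R X : sets M) : Prop :=
  exists (k : num M) (A : sets M),
    (forall i, i < k -> ideal P R (section A i)) /\
    (forall x, x isin X <-> exists i, i < k /\ section A i x).

Definition no_infinite_antichain {M : L2structure} (P R : sets M) : Prop :=
  ~ exists X, antichain P R X /\ infinite X.

Definition no_infinite_strong_antichain {M : L2structure} (P R : sets M) :
    Prop :=
  ~ exists X, strong_antichain P R X /\ infinite X.

Definition no_arbitrarily_large_finite_strong_antichains {M : L2structure}
    (P R : sets M) : Prop :=
  exists k : num M, forall X, finite X -> strong_antichain P R X ->
    forall n, has_size X n -> le n k.

Definition well_partial_order {M : L2structure} (P R : sets M) : Prop :=
  partial_order P R /\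
  (forall F, is_function F (fun _ => True) (mem P) ->
     exists i j x y, i < j /\ pair i x isin F /\ pair j y isin F /\
       pair x y isin R).

Definition bounded_strong_antichains_ideals (M : L2structure) : Prop :=
  forall P R : sets M, partial_order P R ->
    no_arbitrarily_large_finite_strong_antichains P R ->
    finite_union_of_ideals P R P.

Definition strong_antichains_bounded (M : L2structure) : Prop :=
  forall P R : sets M, partial_order P R ->
    no_infinite_strong_antichain P R ->
    no_arbitrarily_large_finite_strong_antichains P R.

Definition no_infinite_strong_antichain_ideals (M : L2structure) : Prop :=
  forall P R : sets M, partial_order P R ->
    no_infinite_strong_antichain P R ->
    finite_union_of_ideals P R P.

Definition initial_intervals_ideals (M : L2structure) : Prop :=
  forall P R : sets M, partial_order P R ->
    no_infinite_antichain P R ->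
    forall I : sets M, initial_interval P R (mem I) ->
    finite_union_of_ideals P R I.

Definition wpo_ideals (M : L2structure) : Prop :=
  forall P R : sets M, well_partial_order P R ->
    finite_union_of_ideals P R P.

Definition pairwise_equivalent (l : list Prop) : Prop :=
  forall A B : Prop, In A l -> In B l -> (A <-> B).

(* Main.v *)
(** For ACA_0 -> (4), call an element good if any two elements above it are
    compatible.  If no element above some [x] is good, splitting repeatedly
    above [x] produces an infinite strong antichain.  Otherwise every element
    is below a good one, compatibility is an equivalence relation on the good
    elements, the least representatives of its classes form a strong antichain,
    hence a finite set, and the elements compatible with a given representative
    form an ideal.  The implications (4) -> (2), (3), (5) and (5) -> (6) follow
    by the pigeonhole principle and by enumerating infinite sets.

    For the reversals let [f] be one-to-one.  A stage [n] is true if [f] stays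
    above [f n] after [n]; the false stages are recognized in finite time, and
    any unbounded set of true stages computes the range of [f].  Order the
    stages linearly as omega (false) + omega* (true), and add a chain [c_s] of
    type omega such that a stage is below [c_s] when it is seen to be false
    before [s].  The strong antichains of this order have at most two elements,
    an ideal that contains all [c_s] separates the false stages from the true
    ones, and so does a bad sequence; hence (2) and (6) give the range.  For (3),
    put a stage below all later stages at which it is seen to be false, and
    replace stage [n] by [n + 1] incomparable elements: there are arbitrarily
    large finite strong antichains, and an infinite one consists of true stages.

    Induction and comprehension are applied to [sigma1] and [delta1] relations
    on environments.  Finite sets are coded by divisibility, as in Goedel's beta
    function; this yields primitive recursion and the pigeonhole principle.
    Arithmetical comprehension follows from [sigma1] comprehension because the
    latter makes every [sigma1] relation bounded in a further set parameter. *)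

From Stdlib Require Import List Arith Lia Classical ClassicalEpsilon
  FunctionalExtensionality Ring.
Require Import Defs.
Import ListNotations.

Local Open Scope L2_scope.

(** * Definable relations *)

Existing Class RCA0.

Section Definability.

Context {M : L2structure}.
Local Notation N := (num M).
Local Notation env := (nat -> num M).

(** Terms are taken semantically, as functions of the environment with constants from [M], so that
    substitution is composition and syntax enters only in [poly_term]. *)
Inductive polynomial : (env -> N) -> Prop :=
| poly_var i : polynomial (fun e => e i)
| poly_const a : polynomial (fun _ => a)
| poly_add t u :
    polynomial t -> polynomial u -> polynomial (fun e => t e + u e)
| poly_mul t u :
    polynomial t -> polynomial u -> polynomial (fun e => t e * u e).

(** Bounded formulas with parameters from [M], up to equivalence. *)
Inductive bdd : (env -> Prop) -> Prop :=
| bdd_eq t u : polynomial t -> polynomial u -> bdd (fun e => t e = u e)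
| bdd_lt t u : polynomial t -> polynomial u -> bdd (fun e => t e < u e)
| bdd_in t X : polynomial t -> bdd (fun e => t e isin X)
| bdd_not p : bdd p -> bdd (fun e => ~ p e)
| bdd_and p q : bdd p -> bdd q -> bdd (fun e => p e /\ q e)
| bdd_all t p : polynomial t -> bdd p ->
    bdd (fun e => forall n, n < t e -> p (scons n e))
| bdd_ext p q : bdd p -> (forall e, p e <-> q e) -> bdd q.

Lemma poly_subst t (s : nat -> env -> N) :
  polynomial t -> (forall i, polynomial (s i)) ->
  polynomial (fun e => t (fun i => s i e)).
Proof.
  intros Ht Hs; induction Ht as [i|a|t u _ IHt _ IHu|t u _ IHt _ IHu].
  - exact (Hs i).
  - constructor.
  - exact (poly_add _ _ IHt IHu).
  - exact (poly_mul _ _ IHt IHu).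
Qed.

Lemma bdd_subst p (s : nat -> env -> N) :
  bdd p -> (forall i, polynomial (s i)) -> bdd (fun e => p (fun i => s i e)).
Proof.
  intros Hp; revert s; induction Hp as
    [t u Ht Hu|t u Ht Hu|t X Ht|p _ IH|p q _ IHp _ IHq|t p Ht _ IH|p q _ IH E];
    intros s Hs.
  - apply (bdd_eq (fun e => t (fun i => s i e)) (fun e => u (fun i => s i e)));
      now apply poly_subst.
  - apply (bdd_lt (fun e => t (fun i => s i e)) (fun e => u (fun i => s i e)));
      now apply poly_subst.
  - apply (bdd_in (fun e => t (fun i => s i e))); now apply poly_subst.
  - exact (bdd_not _ (IH s Hs)).
  - exact (bdd_and _ _ (IHp s Hs) (IHq s Hs)).
  (* The substitution carried under the binder: variable 0 is kept, the other terms read the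
     environment shifted by one. *)
  - pose (s' := fun i => match i with
                         | O => fun e : env => e O
                         | S j => fun e : env => s j (fun i => e (S i))
                         end).
    assert (Hs' : forall i, polynomial (s' i)).
    { intros [|j]; simpl; [constructor|].
      apply (poly_subst (s j) (fun i e => e (S i))); [apply Hs|].
      intros; constructor. }
    apply (bdd_ext _ _ (bdd_all _ _ (poly_subst _ _ Ht Hs) (IH s' Hs'))).
    intros e; split; intros H n Hn; specialize (H n Hn);
      replace (scons n (fun i => s i e)) with (fun i => s' i (scons n e)) in *;
      try assumption;
      apply functional_extensionality; intros [|j]; reflexivity.
  - refine (bdd_ext _ _ (IH s Hs) _). intros e; apply E.
Qed.

Lemma bdd_or p q : bdd p -> bdd q -> bdd (fun e => p e \/ q e).
Proof.
  intros Hp Hq.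
  apply (bdd_ext _ _ (bdd_not _ (bdd_and _ _ (bdd_not _ Hp) (bdd_not _ Hq)))).
  intros e; simpl; tauto.
Qed.

Lemma bdd_imp (p q : env -> Prop) :
  bdd p -> bdd q -> bdd (fun e => p e -> q e).
Proof.
  intros Hp Hq. apply (bdd_ext _ _ (bdd_not _ (bdd_and _ _ Hp (bdd_not _ Hq)))).
  intros e; simpl; tauto.
Qed.

Lemma bdd_ex t p : polynomial t -> bdd p ->
  bdd (fun e => exists n, n < t e /\ p (scons n e)).
Proof.
  intros Ht Hp.
  apply (bdd_ext _ _ (bdd_not _ (bdd_all _ _ Ht (bdd_not _ Hp)))).
  intros e; split.
  - intros H. apply NNPP. intros H'. apply H. intros n Hn Hpn.
    apply H'. now exists n.
  - intros (n & Hn & Hpn) H. exact (H n Hn Hpn).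
Qed.

(** Variables below [d] are read from [e]; the others hold parameters. *)
Definition stack (d : nat) (e p : env) : env :=
  fun i => if Nat.ltb i d then e i else p (i - d)%nat.

Lemma stack_scons d e p n : stack (S d) (scons n e) p = scons n (stack d e p).
Proof. apply functional_extensionality; intros [|i]; reflexivity. Qed.

(** The parameters of several subformulas are laid out one after another in a single environment;
    [o] is the offset and [l] the length of one block. *)
Definition window {A : Type} (o l : nat) (p q : nat -> A) : Prop :=
  forall i, (i < l)%nat -> q (o + i)%nat = p i.

Definition join {A : Type} (l : nat) (p q : nat -> A) : nat -> A :=
  fun i => if Nat.ltb i l then p i else q (i - l)%nat.

Lemma window_join {A : Type} o l l' (p p' q : nat -> A) :
  window o (l + l') (join l p p') q ->
  window o l p q /\ window (o + l) l' p' q.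
Proof.
  unfold window, join; intros H; split; intros i Hi.
  - rewrite H by lia. destruct (Nat.ltb_spec i l); [reflexivity|lia].
  - rewrite <- Nat.add_assoc, H by lia.
    destruct (Nat.ltb_spec (l + i) l); [lia|]. f_equal; lia.
Qed.

(** Constants become variables that read a block of parameters. The depth [d] may exceed [d0],
    because quantifiers add variables, and the offset [o] is free, so that the blocks of two terms
    can be placed side by side. *)
Lemma poly_term t : polynomial t ->
  exists d0 l p, forall d o, (d0 <= d)%nat -> exists u, forall e q,
    window o l p q -> eval (stack d e q) u = t e.
Proof.
  induction 1 as [i|a|t u _ (d1 & l1 & p1 & IHt) _ (d2 & l2 & p2 & IHu)
                     |t u _ (d1 & l1 & p1 & IHt) _ (d2 & l2 & p2 & IHu)].
  - exists (S i), O, (fun _ => 0). intros d o Hd. exists (TVar i).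
    intros e q _; simpl; unfold stack.
    destruct (Nat.ltb_spec i d); [reflexivity|lia].
  - exists O, (S O), (fun _ => a). intros d o _. exists (TVar (d + o)).
    intros e q H; simpl; unfold stack.
    destruct (Nat.ltb_spec (d + o) d); [lia|].
    rewrite <- (H O) by lia. f_equal; lia.
  - exists (max d1 d2), (l1 + l2)%nat, (join l1 p1 p2). intros d o Hd.
    destruct (IHt d o ltac:(lia)) as [t' Ht].
    destruct (IHu d (o + l1)%nat ltac:(lia)) as [u' Hu].
    exists (TAdd t' u'). intros e q [H1 H2]%window_join; simpl.
    now rewrite Ht, Hu.
  - exists (max d1 d2), (l1 + l2)%nat, (join l1 p1 p2). intros d o Hd.
    destruct (IHt d o ltac:(lia)) as [t' Ht].
    destruct (IHu d (o + l1)%nat ltac:(lia)) as [u' Hu].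
    exists (TMul t' u'). intros e q [H1 H2]%window_join; simpl.
    now rewrite Ht, Hu.
Qed.

Lemma eval_lift (e : env) n t : eval (scons n e) (lift t) = eval e t.
Proof. induction t; simpl; congruence. Qed.

(** Back from relations to syntax, with one block of number parameters and one of set parameters.
    [f] is chosen before [b] and [B]: it depends on the layout only. *)
Lemma bdd_formula p : bdd p ->
  exists d0 l a L A, forall d o O1, (d0 <= d)%nat -> exists f, bounded f /\
    forall e b B, window o l a b -> window O1 L A B ->
      (sat (stack d e b) B f <-> p e).
Proof.
  destruct (sets_inhabited M) as [X0].
  induction 1 as
    [t u Ht Hu|t u Ht Hu|t X Ht|p _ (d1 & l1 & a1 & L1 & A1 & IH)
    |p q _ (d1 & l1 & a1 & L1 & A1 & IHp) _ (d2 & l2 & a2 & L2 & A2 & IHq)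
    |t p Ht _ (d2 & l2 & a2 & L2 & A2 & IH)
    |p q _ (d1 & l1 & a1 & L1 & A1 & IH) E].
  - destruct (poly_term _ Ht) as (d1 & l1 & a1 & H1).
    destruct (poly_term _ Hu) as (d2 & l2 & a2 & H2).
    exists (max d1 d2), (l1 + l2)%nat, (join l1 a1 a2), O, (fun _ => X0).
    intros d o O1 Hd.
    destruct (H1 d o ltac:(lia)) as [t' Et].
    destruct (H2 d (o + l1)%nat ltac:(lia)) as [u' Eu].
    exists (FEq t' u'). split; [constructor|].
    intros e b B [W1 W2]%window_join _; simpl. now rewrite Et, Eu.
  - destruct (poly_term _ Ht) as (d1 & l1 & a1 & H1).
    destruct (poly_term _ Hu) as (d2 & l2 & a2 & H2).
    exists (max d1 d2), (l1 + l2)%nat, (join l1 a1 a2), O, (fun _ => X0).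
    intros d o O1 Hd.
    destruct (H1 d o ltac:(lia)) as [t' Et].
    destruct (H2 d (o + l1)%nat ltac:(lia)) as [u' Eu].
    exists (FLt t' u'). split; [constructor|].
    intros e b B [W1 W2]%window_join _; simpl. now rewrite Et, Eu.
  - destruct (poly_term _ Ht) as (d1 & l1 & a1 & H1).
    exists d1, l1, a1, (S O), (fun _ => X).
    intros d o O' Hd.
    destruct (H1 d o Hd) as [t' Et].
    exists (FIn t' O'). split; [constructor|].
    intros e b B W1 W2; simpl. rewrite Et by assumption.
    rewrite <- (W2 O) by lia. now rewrite Nat.add_0_r.
  - exists d1, l1, a1, L1, A1. intros d o O' Hd.
    destruct (IH d o O' Hd) as (f & Hf & E).
    exists (FNot f). split; [now constructor|].
    intros e b B W1 W2; simpl. now rewrite (E e b B W1 W2).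
  - exists (max d1 d2), (l1 + l2)%nat, (join l1 a1 a2),
      (L1 + L2)%nat, (join L1 A1 A2).
    intros d o O' Hd.
    destruct (IHp d o O' ltac:(lia)) as (f & Hf & Ef).
    destruct (IHq d (o + l1)%nat (O' + L1)%nat ltac:(lia)) as (g & Hg & Eg).
    exists (FAnd f g). split; [now constructor|].
    intros e b B [W1 W2]%window_join [V1 V2]%window_join; simpl.
    now rewrite (Ef e b B W1 V1), (Eg e b B W2 V2).
  - destruct (poly_term _ Ht) as (d1 & l1 & a1 & H1).
    exists (max d1 d2), (l1 + l2)%nat, (join l1 a1 a2), L2, A2.
    intros d o O' Hd.
    destruct (H1 d o ltac:(lia)) as [t' Et].
    (* The bound variable raises the depth by one, and [stack_scons] identifies the two readings of
       the environment. *)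
    destruct (IH (S d) (o + l1)%nat O' ltac:(lia)) as (f & Hf & E).
    exists (FAllN (FImp (FLt (TVar O) (lift t')) f)).
    split; [now constructor|].
    intros e b B [W1 W2]%window_join V; simpl.
    split; intros H n; specialize (H n);
      rewrite eval_lift, (Et e b W1), <- stack_scons, (E _ _ _ W2 V) in *;
      exact H.
  - exists d1, l1, a1, L1, A1. intros d o O' Hd.
    destruct (IH d o O' Hd) as (f & Hf & F).
    exists f. split; [assumption|].
    intros e b B W1 W2; simpl. now rewrite (F e b B W1 W2).
Qed.

(** * Sigma-1 and Delta-1 relations *)

Definition sigma1 (p : env -> Prop) : Prop :=
  exists q, bdd q /\ forall e, p e <-> exists n, q (scons n e).

Definition delta1 (p : env -> Prop) : Prop :=
  sigma1 p /\ sigma1 (fun e => ~ p e).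

Lemma sigma1_ext p q : sigma1 p -> (forall e, p e <-> q e) -> sigma1 q.
Proof.
  intros (r & Hr & E) F. exists r; split; [assumption|].
  intros e; now rewrite <- F.
Qed.

Lemma sigma1_subst p (s : nat -> env -> N) :
  sigma1 p -> (forall i, polynomial (s i)) ->
  sigma1 (fun e => p (fun i => s i e)).
Proof.
  intros (q & Hq & E) Hs.
  pose (s' := fun i => match i with
                       | O => fun e : env => e O
                       | S j => fun e : env => s j (fun i => e (S i))
                       end).
  exists (fun e => q (fun i => s' i e)). split.
  - apply bdd_subst; [assumption|].
    intros [|j]; simpl; [constructor|].
    apply (poly_subst (s j) (fun i e => e (S i))); [apply Hs|].
    intros; constructor.
  - intros e. rewrite E.
    assert (F : forall n, scons n (fun i => s i e) = fun i => s' i (scons n e)).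
    { intros n. apply functional_extensionality; intros [|j]; reflexivity. }
    split; intros [n Hn]; exists n; [rewrite <- F|rewrite F]; assumption.
Qed.

Lemma bdd_sigma1 p : bdd p -> sigma1 p.
Proof.
  intros Hp. exists (fun e => p (fun i => e (S i))). split.
  - apply (bdd_subst p (fun i e => e (S i))); [assumption|].
    intros; constructor.
  - intros e; split; [intros H; exists 0; exact H|intros [n H]; exact H].
Qed.

Lemma sigma1_formula (p : N -> Prop) :
  sigma1 (fun e => p (e O)) ->
  exists f e E, Sigma01 f /\ forall n, sat (scons n e) E f <-> p n.
Proof.
  intros (q & Hq & E).
  destruct (bdd_formula q Hq) as (d0 & l & a & L & A & H).
  (* Index 0 will hold the witness and index 1 the argument [n]; then [d0] dummy zeros and the
     parameters follow. *)
  destruct (H (S (S d0)) O O ltac:(lia)) as (f & Hf & F).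
  pose (z := stack d0 (fun _ => 0) a).
  exists (FExN f), z, A. split; [now constructor|].
  intros n. rewrite (E (scons n (fun _ => 0))). simpl.
  assert (K : forall m,
    sat (scons m (scons n z)) A f <-> q (scons m (scons n (fun _ => 0)))).
  { intros m. unfold z. rewrite <- !stack_scons.
    apply F; intros i _; reflexivity. }
  split; intros [m Hm]; exists m; apply K; exact Hm.
Qed.

Context {hM : RCA0 M}.

Lemma sigma1_induction (p : N -> Prop) :
  sigma1 (fun e => p (e O)) ->
  p 0 -> (forall n, p n -> p (n + 1)) -> forall n, p n.
Proof.
  intros (f & e & E & Hf & G)%sigma1_formula H0 HS.
  destruct hM as (_ & I & _).
  intros n; apply G. apply I.
  - assumption.
  - now apply G.
  - intros m Hm; apply G, HS, G, Hm.
Qed.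

Lemma delta1_comprehension (p : N -> Prop) :
  delta1 (fun e => p (e O)) -> exists X : sets M, forall n, n isin X <-> p n.
Proof.
  intros [(q & Hq & E) (q' & Hq' & E')].
  destruct (bdd_formula q Hq) as (d0 & l & a & L & A & H).
  destruct (bdd_formula q' Hq') as (d0' & l' & a' & L' & A' & H').
  destruct (H (S (S (d0 + d0'))) O O ltac:(lia)) as (f & Hf & F).
  (* Comprehension reads both formulas in one environment, so the second one takes its parameters
     after the first [l] numbers and [L] sets. *)
  destruct (H' (S (S (d0 + d0'))) l L ltac:(lia)) as (f' & Hf' & F').
  pose (z := stack (d0 + d0') (fun _ => 0) (join l a a')).
  pose (Z := join L A A').
  assert (W : window O l a (join l a a') /\ window l l' a' (join l a a')).
  { apply window_join. intros i _; reflexivity. }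
  assert (V : window O L A Z /\ window L L' A' Z).
  { apply window_join. intros i _; reflexivity. }
  assert (G : forall n, sat (scons n z) Z (FExN f) <-> p n).
  { intros n. rewrite (E (scons n (fun _ => 0))). simpl.
    assert (K : forall m,
      sat (scons m (scons n z)) Z f <-> q (scons m (scons n (fun _ => 0)))).
    { intros m. unfold z. rewrite <- !stack_scons. now apply F. }
    split; intros [m Hm]; exists m; apply K; exact Hm. }
  assert (G' : forall n, sat (scons n z) Z (FAllN (FNot f')) <-> p n).
  { intros n. simpl.
    assert (K : forall m,
      sat (scons m (scons n z)) Z f' <-> q' (scons m (scons n (fun _ => 0)))).
    { intros m. unfold z. rewrite <- !stack_scons. now apply F'. }
    specialize (E' (scons n (fun _ => 0))). simpl in E'.
    split.
    - intros Hn. apply NNPP. intros C. apply E' in C. destruct C as [m Hm].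
      apply (Hn m), K, Hm.
    - intros Hn m Hm. apply E'; [|exact Hn]. exists m. apply K, Hm. }
  destruct hM as (_ & _ & D).
  destruct (D (FExN f) (FAllN (FNot f'))) with (e := z) (E := Z) as [X HX].
  - now constructor.
  - now constructor; constructor.
  - intros n. now rewrite G, G'.
  - exists X. intros n. now rewrite HX.
Qed.

End Definability.

(** * Arithmetic *)

Ltac poly :=
  first [ apply poly_var | apply poly_const
        | apply poly_add; poly | apply poly_mul; poly ].

Section Arithmetic.

Context {M : L2structure} {hM : RCA0 M}.
Local Notation N := (num M).

Lemma RCA0_basic : basic_axioms M.
Proof. exact (proj1 hM). Qed.

Lemma bdd_induction (p : N -> Prop) :
  bdd (fun e => p (e O)) ->
  p 0 -> (forall n, p n -> p (n + 1)) -> forall n, p n.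
Proof. intros Hp; apply sigma1_induction, bdd_sigma1, Hp. Qed.

Ltac bdd_ind :=
  lazymatch goal with
  | |- forall n, @?p n => refine (bdd_induction p _ _ _); cbv beta
  end.

Lemma num_add_0_r (m : N) : m + 0 = m.
Proof. exact (add_0 M RCA0_basic m). Qed.

Lemma num_add_0_l (n : N) : 0 + n = n.
Proof.
  revert n; bdd_ind.
  - apply bdd_eq; poly.
  - apply num_add_0_r.
  - intros n IH. now rewrite (add_succ M RCA0_basic), IH.
Qed.

Lemma num_add_succ_l (m n : N) : m + 1 + n = m + n + 1.
Proof.
  revert n; bdd_ind.
  - apply bdd_eq; poly.
  - now rewrite !num_add_0_r.
  - intros n IH. now rewrite !(add_succ M RCA0_basic), IH.
Qed.

Lemma num_add_comm (m n : N) : m + n = n + m.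
Proof.
  revert n; bdd_ind.
  - apply bdd_eq; poly.
  - now rewrite num_add_0_r, num_add_0_l.
  - intros n IH. now rewrite (add_succ M RCA0_basic), num_add_succ_l, IH.
Qed.

Lemma num_add_assoc (m n k : N) : m + (n + k) = m + n + k.
Proof.
  revert k; bdd_ind.
  - apply bdd_eq; poly.
  - now rewrite !num_add_0_r.
  - intros k IH. now rewrite !(add_succ M RCA0_basic), IH.
Qed.

Lemma num_mul_0_r (m : N) : m * 0 = 0.
Proof. exact (mul_0 M RCA0_basic m). Qed.

Lemma num_mul_succ_r (m n : N) : m * (n + 1) = m * n + m.
Proof. exact (mul_succ M RCA0_basic m n). Qed.

Lemma num_mul_0_l (n : N) : 0 * n = 0.
Proof.
  revert n; bdd_ind.
  - apply bdd_eq; poly.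
  - apply num_mul_0_r.
  - intros n IH. now rewrite num_mul_succ_r, IH, num_add_0_r.
Qed.

Lemma num_mul_succ_l (m n : N) : (m + 1) * n = m * n + n.
Proof.
  revert n; bdd_ind.
  - apply bdd_eq; poly.
  - now rewrite !num_mul_0_r, num_add_0_r.
  - intros n IH. rewrite !num_mul_succ_r, IH, <- !num_add_assoc. f_equal.
    rewrite !num_add_assoc. f_equal. apply num_add_comm.
Qed.

Lemma num_mul_comm (m n : N) : m * n = n * m.
Proof.
  revert n; bdd_ind.
  - apply bdd_eq; poly.
  - now rewrite num_mul_0_r, num_mul_0_l.
  - intros n IH. now rewrite num_mul_succ_r, num_mul_succ_l, IH.
Qed.

Lemma num_mul_1_l (n : N) : 1 * n = n.
Proof.
  rewrite <- (num_add_0_l 1), num_mul_succ_l, num_mul_0_l.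
  apply num_add_0_l.
Qed.

Lemma num_mul_add_l (m n k : N) : (m + n) * k = m * k + n * k.
Proof.
  revert k; bdd_ind.
  - apply bdd_eq; poly.
  - now rewrite !num_mul_0_r, num_add_0_r.
  - intros k IH. rewrite !num_mul_succ_r, IH, <- !num_add_assoc. f_equal.
    rewrite !num_add_assoc. f_equal. apply num_add_comm.
Qed.

Lemma num_mul_assoc (m n k : N) : m * (n * k) = m * n * k.
Proof.
  revert k; bdd_ind.
  - apply bdd_eq; poly.
  - now rewrite !num_mul_0_r.
  - intros k IH. rewrite !num_mul_succ_r, <- IH.
    rewrite (num_mul_comm m (n * k + n)), num_mul_add_l.
    f_equal; apply num_mul_comm.
Qed.

Lemma num_semi_ring : semi_ring_theory 0 1 (@add M) (@mul M) (@eq N).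
Proof.
  constructor.
  - apply num_add_0_l.
  - apply num_add_comm.
  - apply num_add_assoc.
  - apply num_mul_1_l.
  - apply num_mul_0_l.
  - apply num_mul_comm.
  - apply num_mul_assoc.
  - apply num_mul_add_l.
Qed.

Add Ring num_ring : num_semi_ring.

Lemma num_add_cancel (k m n : N) : m + k = n + k -> m = n.
Proof.
  intros H. apply NNPP. intros C.
  cut (m + k <> n + k); [tauto|clear H].
  revert k; bdd_ind.
  - apply (bdd_not (fun e => m + e O = n + e O)), bdd_eq; poly.
  - now rewrite !num_add_0_r.
  - intros k IH H. apply IH, (succ_inj M RCA0_basic).
    rewrite <- !num_add_assoc. exact H.
Qed.

Lemma num_lt_succ (m n : N) : m < n + 1 <-> m < n \/ m = n.
Proof. exact (lt_succ M RCA0_basic m n). Qed.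

Lemma num_nlt_0 (m : N) : ~ m < 0.
Proof. exact (nlt_0 M RCA0_basic m). Qed.

Lemma num_succ_neq0 (m : N) : m + 1 <> 0.
Proof. exact (succ_neq0 M RCA0_basic m). Qed.

Lemma num_lt_succ_r (m n : N) : m < n -> m + 1 < n + 1.
Proof.
  revert n; bdd_ind.
  - apply bdd_imp; apply bdd_lt; poly.
  - intros H. now apply num_nlt_0 in H.
  - intros n IH H. apply num_lt_succ. apply num_lt_succ in H.
    destruct H as [H| ->]; auto.
Qed.

Lemma num_0_lt_succ (n : N) : 0 < n + 1.
Proof.
  revert n; bdd_ind.
  - apply bdd_lt; poly.
  - apply num_lt_succ; auto.
  - intros n IH. apply num_lt_succ; auto.
Qed.

Lemma num_lt_iff (m n : N) : m < n <-> exists k, n = m + k + 1.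
Proof.
  split.
  (* The bound [k < n] keeps the induction formula bounded. *)
  - intros H. cut (m < n -> exists k, k < n /\ n = m + k + 1).
    { intros F. destruct (F H) as (k & _ & E). now exists k. }
    clear H; revert n; bdd_ind.
    + apply bdd_imp; [apply bdd_lt; poly|].
      apply (bdd_ex (fun e => e O) (fun e => e (S O) = m + e O + 1)); [poly|].
      apply bdd_eq; poly.
    + intros H. now apply num_nlt_0 in H.
    + intros n IH H. apply num_lt_succ in H. destruct H as [H|H].
      * destruct (IH H) as (k & Hk & E). exists (k + 1). split.
        { now apply num_lt_succ_r. } rewrite E; ring.
      * exists 0. split; [apply num_0_lt_succ|]. rewrite H; ring.
  - intros (k & ->). revert k; bdd_ind.
    + apply bdd_lt; poly.
    + apply num_lt_succ; right; ring.
    + intros k IH. apply num_lt_succ. left. now rewrite num_add_assoc.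
Qed.

Lemma num_eq0_or_pos (k : N) : k = 0 \/ 0 < k.
Proof.
  revert k; bdd_ind.
  - apply bdd_or; [apply bdd_eq|apply bdd_lt]; poly.
  - now left.
  - intros n _; right; apply num_0_lt_succ.
Qed.

Lemma num_le_iff (m n : N) : le m n <-> exists k, n = m + k.
Proof.
  unfold le; rewrite num_lt_iff; split.
  - intros [[k ->]| ->]; [exists (k + 1)|exists 0]; ring.
  - intros [k ->].
    assert (D : k = 0 \/ exists j, k = j + 1).
    { destruct (num_eq0_or_pos k) as [H|H]; [now left|right].
      apply num_lt_iff in H. destruct H as [j ->]. exists j; ring. }
    destruct D as [-> |[j ->]]; [right; ring|left; exists j; ring].
Qed.

Lemma num_le_refl (m : N) : le m m.
Proof. now right. Qed.

Lemma num_lt_irrefl (m : N) : ~ m < m.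
Proof.
  intros [k H]%num_lt_iff. apply (num_succ_neq0 k), (num_add_cancel m).
  rewrite num_add_0_l. rewrite H at 2. ring.
Qed.

Lemma num_lt_trans (m n k : N) : m < n -> n < k -> m < k.
Proof.
  rewrite !num_lt_iff. intros [a ->] [b ->]. exists (a + b + 1); ring.
Qed.

Lemma num_le_lt_trans (m n k : N) : le m n -> n < k -> m < k.
Proof. intros [H| ->]; [apply num_lt_trans, H|auto]. Qed.

Lemma num_lt_le_trans (m n k : N) : m < n -> le n k -> m < k.
Proof. intros H [K| <-]; [apply (num_lt_trans _ _ _ H K)|auto]. Qed.

Lemma num_le_trans (m n k : N) : le m n -> le n k -> le m k.
Proof.
  intros H [K|<-]; [left|assumption]. now apply (num_le_lt_trans _ _ _ H).
Qed.

Lemma num_lt_succ_iff_le (m n : N) : m < n + 1 <-> le m n.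
Proof. apply num_lt_succ. Qed.

Lemma num_succ_le_iff (m n : N) : le (m + 1) n <-> m < n.
Proof.
  rewrite num_le_iff, num_lt_iff. split; intros [k ->]; exists k; ring.
Qed.

Lemma num_lt_total (m n : N) : m < n \/ m = n \/ n < m.
Proof.
  revert n; bdd_ind.
  - apply bdd_or; [apply bdd_lt; poly|apply bdd_or;
      [apply bdd_eq|apply bdd_lt]; poly].
  - destruct (proj2 (num_le_iff 0 m)) as [H|H]; auto.
    exists m; ring.
  - intros n [H|[H|H]].
    + left; apply num_lt_succ; auto.
    + left; apply num_lt_succ; auto.
    + apply num_succ_le_iff in H. destruct H as [H|H]; auto.
Qed.

Lemma num_nlt_le (m n : N) : ~ m < n -> le n m.
Proof. destruct (num_lt_total m n) as [H|[->|H]]; [tauto|now right|now left]. Qed.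

Lemma num_nle_lt (m n : N) : ~ le m n -> n < m.
Proof.
  destruct (num_lt_total m n) as [H|[->|H]]; unfold le; tauto.
Qed.

Lemma num_lt_add1 (m : N) : m < m + 1.
Proof. apply num_lt_succ; auto. Qed.

Lemma num_0_le (m : N) : le 0 m.
Proof. apply num_le_iff. exists m; ring. Qed.

Lemma num_zero_or_succ (m : N) : m = 0 \/ exists k, m = k + 1.
Proof.
  destruct (num_0_le m) as [H|H]; [right|now left].
  apply num_lt_iff in H. destruct H as [k ->]. exists k; ring.
Qed.

Lemma num_lt_neq (m n : N) : m <> n -> m < n \/ n < m.
Proof. destruct (num_lt_total m n) as [H|[H|H]]; tauto. Qed.

End Arithmetic.

(** Fails when the fact is already a hypothesis, so that repeated saturation by [ord_step] does not
    add it again. *)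
Ltac fresh_fact P :=
  lazymatch goal with
  | _ : P |- _ => fail
  | _ => idtac
  end.

Ltac ord_step :=
  match goal with
  | H : False |- _ => destruct H
  | H : ?a < ?a |- _ => destruct (num_lt_irrefl a H)
  | H : ?a < 0 |- _ => destruct (num_nlt_0 a H)
  | H : ~ ?a < ?b |- _ => apply num_nlt_le in H
  | H : ~ le ?a ?b |- _ => apply num_nle_lt in H
  | H : ?a < ?b + 1 |- _ =>
      fresh_fact (le a b); pose proof (proj1 (num_lt_succ_iff_le a b) H)
  | H : le (?a + 1) ?b |- _ =>
      fresh_fact (a < b); pose proof (proj1 (num_succ_le_iff a b) H)
  | H : _ /\ _ |- _ => destruct H
  | H1 : ?a < ?b, H2 : ?b < ?c |- _ =>
      fresh_fact (a < c); pose proof (num_lt_trans a b c H1 H2)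
  | H1 : le ?a ?b, H2 : ?b < ?c |- _ =>
      fresh_fact (a < c); pose proof (num_le_lt_trans a b c H1 H2)
  | H1 : ?a < ?b, H2 : le ?b ?c |- _ =>
      fresh_fact (a < c); pose proof (num_lt_le_trans a b c H1 H2)
  | H1 : le ?a ?b, H2 : le ?b ?c |- _ =>
      fresh_fact (le a c); pose proof (num_le_trans a b c H1 H2)
  end.

(** Refutes the negated goal by closing the hypotheses under transitivity. *)
Ltac ord :=
  solve [subst;
  match goal with
  | |- ?a < ?b => apply NNPP; intro; repeat ord_step
  | |- le ?a ?b => apply NNPP; intro; repeat ord_step
  | |- ?a <> ?b => intro; subst; repeat ord_step
  | |- ~ _ => intro; repeat ord_step
  | |- ?a = ?b =>
      let H := fresh in
      apply NNPP; intro H; apply num_lt_neq in H; destruct H; repeat ord_step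
  | |- _ => exfalso; repeat ord_step
  end].

(** * Closure properties of definable relations *)

Section Closure.

Context {M : L2structure} {hM : RCA0 M}.
Local Notation N := (num M).
Local Notation env := (nat -> num M).

Add Ring num_ring_closure : (@num_semi_ring M hM).

(** Deletes entry [k]; relations are weakened in this way past a new bounding variable. *)
Definition skip (k : nat) (e : env) : env :=
  fun i => if Nat.ltb i k then e i else e (S i).

Lemma bdd_skip k (q : env -> Prop) : bdd q -> bdd (fun e => q (skip k e)).
Proof.
  intros Hq. apply (bdd_subst q (fun i e => skip k e i) Hq).
  intros i; unfold skip; destruct (Nat.ltb i k); constructor.
Qed.

Lemma sigma1_skip k (q : env -> Prop) :
  sigma1 q -> sigma1 (fun e => q (skip k e)).
Proof.
  intros Hq. apply (sigma1_subst q (fun i e => skip k e i) Hq).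
  intros i; unfold skip; destruct (Nat.ltb i k); constructor.
Qed.

Lemma skip0 n (e : env) : skip O (scons n e) = e.
Proof. apply functional_extensionality; intros i; reflexivity. Qed.

Lemma skipS k n (e : env) : skip (S k) (scons n e) = scons n (skip k e).
Proof. apply functional_extensionality; intros [|i]; reflexivity. Qed.

(** Collection: by Sigma-1 induction on [j] there is a bound that serves all [i < j]. *)
Lemma bdd_bounding (q : N -> N -> Prop) k :
  bdd (fun e => q (e O) (e 1%nat)) ->
  (forall i, i < k -> exists n, q n i) ->
  exists b, forall i, i < k -> exists n, n < b /\ q n i.
Proof.
  intros Hq H.
  (* The second premise [i < k] stays fixed while the first becomes [i < j], so that the induction
     can run over all [j]. *)
  cut (exists b, forall i, i < k -> i < k -> exists n, n < b /\ q n i).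
  { intros (b & Hb). exists b; auto. }
  apply (sigma1_induction
    (fun j => exists b, forall i, i < j -> i < k -> exists n, n < b /\ q n i)).
  - exists (fun e => forall i, i < e 1%nat ->
      i < k -> exists n, n < e O /\ q n i).
    split; [|intros e; reflexivity].
    apply (bdd_all (fun e => e 1%nat)
      (fun e => e O < k -> exists n, n < e 1%nat /\ q n (e O))); [poly|].
    apply bdd_imp; [apply bdd_lt; poly|].
    apply (bdd_ex (fun e => e 1%nat) (fun e => q (e O) (e 1%nat)));
      [poly|assumption].
  - exists 0. intros i Hi; ord.
  - intros j (b & Hb).
    destruct (classic (j < k)) as [Hj|Hj].
    + destruct (H j Hj) as [n Hn]. exists (b + n + 1). intros i Hi Hik.
      apply num_lt_succ in Hi. destruct Hi as [Hi| ->].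
      * destruct (Hb i Hi Hik) as (m & Hm & Hq').
        exists m; split; [|assumption].
        apply (num_lt_trans _ _ _ Hm), num_lt_iff. now exists n.
      * exists n; split; [|assumption].
        apply num_lt_iff. exists b; ring.
    + exists b. intros i Hi Hik. apply num_lt_succ in Hi.
      destruct Hi as [Hi| ->]; [auto|tauto].
Qed.

(** Any common strict bound of the two witnesses is a witness for the conjunction, and both original
    quantifiers become bounded. *)
Lemma sigma1_and (p q : env -> Prop) :
  sigma1 p -> sigma1 q -> sigma1 (fun e => p e /\ q e).
Proof.
  intros (p' & Hp & Ep) (q' & Hq & Eq).
  exists (fun e => (exists n, n < e O /\ p' (skip 1 (scons n e))) /\
                   (exists n, n < e O /\ q' (skip 1 (scons n e)))).
  split.
  - apply bdd_and;
      [apply (bdd_ex (fun e => e O) (fun e => p' (skip 1 e)))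
      |apply (bdd_ex (fun e => e O) (fun e => q' (skip 1 e)))];
      first [poly | now apply bdd_skip].
  - intros e. rewrite Ep, Eq. split.
    + intros [[n Hn] [m Hm]]. exists (n + m + 1).
      split; [exists n|exists m]; (split; [|rewrite skipS, skip0; assumption]);
        apply num_lt_iff; [exists m|exists n]; simpl; [|rewrite (num_add_comm m)];
        reflexivity.
    + intros (b & (n & _ & Hn) & (m & _ & Hm)).
      rewrite skipS, skip0 in Hn, Hm. split; eauto.
Qed.

Lemma sigma1_or (p q : env -> Prop) :
  sigma1 p -> sigma1 q -> sigma1 (fun e => p e \/ q e).
Proof.
  intros (p' & Hp & Ep) (q' & Hq & Eq).
  exists (fun e => p' e \/ q' e). split; [now apply bdd_or|].
  intros e. rewrite Ep, Eq. split.
  - intros [[n Hn]|[n Hn]]; exists n; auto.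
  - intros [n [Hn|Hn]]; eauto.
Qed.

(** Two unbounded quantifiers are contracted into one over a common bound. *)
Lemma sigma1_ex (p : N -> env -> Prop) :
  sigma1 (fun e => p (e O) (fun i => e (S i))) ->
  sigma1 (fun e => exists n, p n e).
Proof.
  intros (q & Hq & E).
  exists (fun e => exists n, n < e O /\ exists m, m < e O /\
    q (skip 2 (scons m (scons n e)))).
  split.
  - apply (bdd_ex (fun e => e O) (fun e => exists m, m < e 1%nat /\
      q (skip 2 (scons m e)))); [poly|].
    apply (bdd_ex (fun e => e 1%nat) (fun e => q (skip 2 e))); [poly|].
    now apply bdd_skip.
  - intros e. split.
    + intros [n Hn]. apply (E (scons n e)) in Hn. destruct Hn as [m Hm].
      exists (n + m + 1). exists n; split.
      { apply num_lt_iff. now exists m. }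
      exists m; split; [|now rewrite !skipS, skip0].
      apply num_lt_iff. exists n. simpl; now rewrite (num_add_comm m).
    + intros (b & n & _ & m & _ & H). exists n.
      apply (E (scons n e)). exists m. now rewrite !skipS, skip0 in H.
Qed.

(** Collection replaces the witnesses for all [n < t e] by one bound, so the unbounded quantifier
    moves to the front. *)
Lemma sigma1_all_lt_poly (t : env -> N) (p : N -> env -> Prop) :
  polynomial t -> sigma1 (fun e => p (e O) (fun i => e (S i))) ->
  sigma1 (fun e => forall n, n < t e -> p n e).
Proof.
  intros Ht (q & Hq & E).
  exists (fun e => forall n, n < t (fun i => e (S i)) -> exists m, m < e O /\
    q (skip 2 (scons m (scons n e)))).
  split.
  - apply (bdd_all (fun e => t (fun i => e (S i)))
      (fun e => exists m, m < e 1%nat /\ q (skip 2 (scons m e)))).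
    + apply (poly_subst t (fun i e => e (S i))); [assumption|intros; poly].
    + apply (bdd_ex (fun e => e 1%nat) (fun e => q (skip 2 e))); [poly|].
      now apply bdd_skip.
  - intros e.
    assert (F : forall m n b, skip 2 (scons m (scons n (scons b e))) =
                              scons m (scons n e)).
    { intros m n b. now rewrite !skipS, skip0. }
    split.
    + intros H.
      cut (exists b, forall n, n < t e ->
             exists m, m < b /\ q (scons m (scons n e))).
      { intros [b Hb]. exists b. intros n Hn.
        destruct (Hb n Hn) as (m & Hm & Hq'). exists m. now rewrite F. }
      apply (bdd_bounding (fun m n => q (scons m (scons n e)))).
      (* Only [m] and [n] stay variable; the entries of [e] are substituted as constants. *)
      * apply (bdd_ext (fun e' => q (fun i => match i with
            | O => e' O | S O => e' (S O) | S (S j) => e j end))).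
        { apply (bdd_subst q (fun i e' => match i with
            | O => e' O | S O => e' (S O) | S (S j) => e j end) Hq).
          intros [|[|j]]; poly. }
        intros e'.
        replace (scons (e' O) (scons (e' 1%nat) e)) with
          (fun i => match i with
            | O => e' O | S O => e' (S O) | S (S j) => e j end);
          [reflexivity|].
        apply functional_extensionality; intros [|[|j]]; reflexivity.
      * intros n Hn. apply (E (scons n e)), H, Hn.
    + intros (b & Hb) n Hn. apply (E (scons n e)).
      destruct (Hb n Hn) as (m & _ & Hm). exists m. now rewrite F in Hm.
Qed.

Lemma bdd_delta1 (p : env -> Prop) : bdd p -> delta1 p.
Proof. split; apply bdd_sigma1; [|apply bdd_not]; assumption. Qed.

Lemma delta1_sigma1 (p : env -> Prop) : delta1 p -> sigma1 p.
Proof. now intros [H _]. Qed.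

Lemma delta1_ext (p q : env -> Prop) :
  delta1 p -> (forall e, p e <-> q e) -> delta1 q.
Proof.
  intros [H1 H2] E; split; [apply (sigma1_ext _ _ H1 E)|].
  apply (sigma1_ext _ _ H2). intros e; now rewrite E.
Qed.

Lemma delta1_subst (p : env -> Prop) (s : nat -> env -> N) :
  delta1 p -> (forall i, polynomial (s i)) ->
  delta1 (fun e => p (fun i => s i e)).
Proof.
  intros [H1 H2] Hs; split.
  - now apply sigma1_subst.
  - now apply (sigma1_subst (fun e => ~ p e)).
Qed.

Lemma delta1_not (p : env -> Prop) : delta1 p -> delta1 (fun e => ~ p e).
Proof.
  intros [H1 H2]; split; [assumption|].
  apply (sigma1_ext _ _ H1). intros e; tauto.
Qed.

Lemma delta1_and (p q : env -> Prop) :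
  delta1 p -> delta1 q -> delta1 (fun e => p e /\ q e).
Proof.
  intros [P P'] [Q Q']; split; [now apply sigma1_and|].
  apply (sigma1_ext _ _ (sigma1_or _ _ P' Q')). intros e; tauto.
Qed.

Lemma delta1_or (p q : env -> Prop) :
  delta1 p -> delta1 q -> delta1 (fun e => p e \/ q e).
Proof.
  intros [P P'] [Q Q']; split; [now apply sigma1_or|].
  apply (sigma1_ext _ _ (sigma1_and _ _ P' Q')). intros e; tauto.
Qed.

Lemma delta1_imp (p q : env -> Prop) :
  delta1 p -> delta1 q -> delta1 (fun e => p e -> q e).
Proof.
  intros P Q. apply (delta1_ext _ _ (delta1_or _ _ (delta1_not _ P) Q)).
  intros e; tauto.
Qed.

Lemma delta1_iff (p q : env -> Prop) :
  delta1 p -> delta1 q -> delta1 (fun e => p e <-> q e).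
Proof. intros P Q. apply delta1_and; now apply delta1_imp. Qed.

Lemma sigma1_imp (p q : env -> Prop) :
  delta1 p -> sigma1 q -> sigma1 (fun e => p e -> q e).
Proof.
  intros [_ P] Q. apply (sigma1_ext _ _ (sigma1_or _ _ P Q)).
  intros e; tauto.
Qed.

(** The graph of [t] is [delta1]; the value is the variable of index [0]. *)
Definition delta1_fun (t : env -> N) : Prop :=
  delta1 (fun e => e O = t (fun i => e (S i))).

Lemma delta1_fun_subst (t : env -> N) (s : nat -> env -> N) :
  delta1_fun t -> (forall i, polynomial (s i)) ->
  delta1_fun (fun e => t (fun i => s i e)).
Proof.
  intros Ht Hs.
  apply (delta1_subst (fun e => e O = t (fun i => e (S i)))
    (fun i => match i with O => fun e => e O
              | S j => fun e => s j (fun i => e (S i)) end) Ht).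
  intros [|j]; [poly|].
  apply (poly_subst (s j) (fun i e => e (S i))); [apply Hs|intros; poly].
Qed.

(** Naming the value by an existential quantifier keeps the relation Sigma-1. As this applies to the
    negation as well, Delta-1 relations are closed under substitution of Delta-1 functions. *)
Lemma sigma1_let (p : N -> env -> Prop) t :
  delta1_fun t -> sigma1 (fun e => p (e O) (fun i => e (S i))) ->
  sigma1 (fun e => p (t e) e).
Proof.
  intros [Ht _] Hp.
  apply (sigma1_ext (fun e => exists n, n = t e /\ p n e)).
  - apply (sigma1_ex (fun n e => n = t e /\ p n e)). now apply sigma1_and.
  - intros e; split; [intros (n & -> & H)|intros H; exists (t e)]; auto.
Qed.

Lemma delta1_let (p : N -> env -> Prop) t :
  delta1_fun t -> delta1 (fun e => p (e O) (fun i => e (S i))) ->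
  delta1 (fun e => p (t e) e).
Proof.
  intros Ht [H1 H2]; split.
  - now apply sigma1_let.
  - now apply (sigma1_let (fun n e => ~ p n e)).
Qed.

Lemma delta1_let2 (p : N -> N -> env -> Prop) t u :
  delta1_fun t -> delta1_fun u ->
  delta1 (fun e => p (e O) (e 1%nat) (fun i => e (S (S i)))) ->
  delta1 (fun e => p (t e) (u e) e).
Proof.
  intros Ht Hu Hp. apply (delta1_let (fun n e => p (t e) n e) u Hu).
  apply (delta1_let (fun n e => p n (e O) (fun i => e (S i)))
                    (fun e => t (fun i => e (S i)))); [|exact Hp].
  apply (delta1_fun_subst t (fun i e => e (S i)) Ht). intros; poly.
Qed.

Lemma poly_delta1_fun t : polynomial t -> delta1_fun t.
Proof.
  intros Ht. apply bdd_delta1, bdd_eq; [poly|].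
  apply (poly_subst t (fun i e => e (S i)) Ht). intros; poly.
Qed.

Lemma delta1_fun_var i : delta1_fun (fun e => e i).
Proof. apply poly_delta1_fun; poly. Qed.

Lemma delta1_fun_const a : delta1_fun (fun _ => a).
Proof. apply poly_delta1_fun; poly. Qed.

Lemma delta1_fun_weaken t :
  delta1_fun t -> delta1_fun (fun e => t (fun i => e (S i))).
Proof.
  intros Ht. apply (delta1_fun_subst t (fun i e => e (S i)) Ht).
  intros; poly.
Qed.

Lemma delta1_fun_add t u :
  delta1_fun t -> delta1_fun u -> delta1_fun (fun e => t e + u e).
Proof.
  intros Ht Hu.
  apply (delta1_let2 (fun a b e => e O = a + b) _ _
    (delta1_fun_weaken t Ht) (delta1_fun_weaken u Hu)).
  apply bdd_delta1, bdd_eq; poly.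
Qed.

Lemma delta1_fun_mul t u :
  delta1_fun t -> delta1_fun u -> delta1_fun (fun e => t e * u e).
Proof.
  intros Ht Hu.
  apply (delta1_let2 (fun a b e => e O = a * b) _ _
    (delta1_fun_weaken t Ht) (delta1_fun_weaken u Hu)).
  apply bdd_delta1, bdd_eq; poly.
Qed.

Lemma delta1_fun_pair t u :
  delta1_fun t -> delta1_fun u -> delta1_fun (fun e => pair (t e) (u e)).
Proof.
  intros Ht Hu. unfold pair.
  repeat first [apply delta1_fun_add | apply delta1_fun_mul]; assumption.
Qed.

Lemma delta1_fun_app (h : N -> N) t :
  delta1_fun (fun e => h (e O)) -> delta1_fun t ->
  delta1_fun (fun e => h (t e)).
Proof.
  intros Hh Ht.
  apply (delta1_let (fun a e => e O = h a) _ (delta1_fun_weaken t Ht)).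
  apply (delta1_subst (fun e => e O = h (e 1%nat))
    (fun i e => match i with O => e 1%nat | _ => e O end) Hh).
  intros [|i]; poly.
Qed.

Lemma delta1_eq t u :
  delta1_fun t -> delta1_fun u -> delta1 (fun e => t e = u e).
Proof.
  intros Ht Hu.
  apply (delta1_let2 (fun a b e => a = b) _ _ Ht Hu).
  apply bdd_delta1, bdd_eq; poly.
Qed.

Lemma delta1_lt t u :
  delta1_fun t -> delta1_fun u -> delta1 (fun e => t e < u e).
Proof.
  intros Ht Hu.
  apply (delta1_let2 (fun a b e => a < b) _ _ Ht Hu).
  apply bdd_delta1, bdd_lt; poly.
Qed.

Lemma delta1_le t u :
  delta1_fun t -> delta1_fun u -> delta1 (fun e => le (t e) (u e)).
Proof. intros Ht Hu. apply delta1_or; [apply delta1_lt|apply delta1_eq]; auto. Qed.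

Lemma delta1_mem t X : delta1_fun t -> delta1 (fun e => t e isin X).
Proof.
  intros Ht. apply (delta1_let (fun a e => a isin X) _ Ht).
  apply bdd_delta1, (bdd_in (fun e => e O)); poly.
Qed.

(** Decided by excluded middle: [P] is replaced by [0 = 0] or by [0 = 1]. *)
Lemma delta1_const (P : Prop) : delta1 (fun _ : env => P).
Proof.
  apply (delta1_ext (fun _ => (0 : N) =
    if excluded_middle_informative P then 0 else 1)).
  - apply delta1_eq; apply delta1_fun_const.
  - intros _. destruct (excluded_middle_informative P); [tauto|].
    split; [|tauto]. intros H. exfalso.
    apply (num_succ_neq0 0). now rewrite num_add_0_l.
Qed.

Lemma sigma1_pred1 (p : N -> Prop) t :
  sigma1 (fun e => p (e O)) -> delta1_fun t -> sigma1 (fun e => p (t e)).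
Proof. intros Hp Ht. now apply (sigma1_let (fun a _ => p a)). Qed.

Lemma delta1_pred1 (p : N -> Prop) t :
  delta1 (fun e => p (e O)) -> delta1_fun t -> delta1 (fun e => p (t e)).
Proof. intros Hp Ht. now apply (delta1_let (fun a _ => p a)). Qed.

Lemma delta1_pred2 (p : N -> N -> Prop) t u :
  delta1 (fun e => p (e O) (e 1%nat)) -> delta1_fun t -> delta1_fun u ->
  delta1 (fun e => p (t e) (u e)).
Proof. intros Hp Ht Hu. now apply (delta1_let2 (fun a b _ => p a b)). Qed.

Lemma sigma1_pred2 (p : N -> N -> Prop) t u :
  sigma1 (fun e => p (e O) (e 1%nat)) -> delta1_fun t -> delta1_fun u ->
  sigma1 (fun e => p (t e) (u e)).
Proof.
  intros Hp Ht Hu. apply (sigma1_let (fun n e => p (t e) n) u Hu).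
  apply (sigma1_let (fun n e => p n (e O)) (fun e => t (fun i => e (S i))));
    [|exact Hp].
  now apply delta1_fun_weaken.
Qed.

Lemma sigma1_all_lt t (p : N -> env -> Prop) :
  delta1_fun t -> sigma1 (fun e => p (e O) (fun i => e (S i))) ->
  sigma1 (fun e => forall n, n < t e -> p n e).
Proof.
  intros Ht Hp.
  apply (sigma1_let (fun b e => forall n, n < b -> p n e) t Ht).
  apply (sigma1_all_lt_poly (fun e => e O) (fun n e => p n (fun i => e (S i))));
    [poly|].
  exact (sigma1_skip 1 _ Hp).
Qed.

Lemma sigma1_ex_lt t (p : N -> env -> Prop) :
  delta1_fun t -> sigma1 (fun e => p (e O) (fun i => e (S i))) ->
  sigma1 (fun e => exists n, n < t e /\ p n e).
Proof.
  intros Ht Hp. apply (sigma1_ex (fun n e => n < t e /\ p n e)).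
  apply sigma1_and; [|assumption].
  apply delta1_sigma1, delta1_lt; [apply delta1_fun_var|].
  now apply delta1_fun_weaken.
Qed.

Lemma delta1_all_lt t (p : N -> env -> Prop) :
  delta1_fun t -> delta1 (fun e => p (e O) (fun i => e (S i))) ->
  delta1 (fun e => forall n, n < t e -> p n e).
Proof.
  intros Ht [H1 H2]; split; [now apply sigma1_all_lt|].
  apply (sigma1_ext _ _ (sigma1_ex_lt t (fun n e => ~ p n e) Ht H2)).
  intros e; split.
  - intros (n & Hn & C) H. exact (C (H n Hn)).
  - intros H. apply NNPP; intros C. apply H. intros n Hn.
    apply NNPP; intros C'. apply C. now exists n.
Qed.

Lemma delta1_ex_lt t (p : N -> env -> Prop) :
  delta1_fun t -> delta1 (fun e => p (e O) (fun i => e (S i))) ->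
  delta1 (fun e => exists n, n < t e /\ p n e).
Proof.
  intros Ht [H1 H2]; split; [now apply sigma1_ex_lt|].
  apply (sigma1_ext _ _ (sigma1_all_lt t (fun n e => ~ p n e) Ht H2)).
  intros e; split.
  - intros H (n & Hn & C). exact (H n Hn C).
  - intros H n Hn C. apply H. now exists n.
Qed.

End Closure.

(** Hypotheses and hints of the form [delta1_fun (fun e => h (e 0))] or
    [delta1 (fun e => p (e 0) (e 1))] provide the atomic cases. *)
Ltac definable_fun :=
  cbv beta;
  lazymatch goal with
  | |- delta1_fun (fun e => e ?i) => apply delta1_fun_var
  | |- delta1_fun (fun _ => ?a) => apply delta1_fun_const
  | |- delta1_fun (fun e => @?t e + @?u e) =>
      apply (delta1_fun_add t u); definable_fun
  | |- delta1_fun (fun e => @?t e * @?u e) =>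
      apply (delta1_fun_mul t u); definable_fun
  | |- delta1_fun (fun e => pair (@?t e) (@?u e)) =>
      apply (delta1_fun_pair t u); definable_fun
  | |- delta1_fun (fun e => ?h (@?t e)) =>
      apply (delta1_fun_app h t); [solve [eauto with definable]|definable_fun]
  end.

Ltac definable :=
  cbv beta;
  lazymatch goal with
  | |- delta1 (fun _ => ?P) => apply (delta1_const P)
  | |- delta1 (fun e => ~ @?p e) => apply (delta1_not p); definable
  | |- delta1 (fun e => @?p e /\ @?q e) => apply (delta1_and p q); definable
  | |- delta1 (fun e => @?p e \/ @?q e) => apply (delta1_or p q); definable
  | |- delta1 (fun e => @?p e <-> @?q e) => apply (delta1_iff p q); definable
  | |- delta1 (fun e => forall n, n < @?t e -> @?p e n) =>
      apply (delta1_all_lt t (fun n e => p e n)); [definable_fun|definable]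
  | |- delta1 (fun e => exists n, n < @?t e /\ @?p e n) =>
      apply (delta1_ex_lt t (fun n e => p e n)); [definable_fun|definable]
  | |- delta1 (fun e => @?p e -> @?q e) => apply (delta1_imp p q); definable
  | |- delta1 (fun e => @?t e = @?u e) => apply (delta1_eq t u); definable_fun
  | |- delta1 (fun e => @?t e < @?u e) => apply (delta1_lt t u); definable_fun
  | |- delta1 (fun e => le (@?t e) (@?u e)) =>
      apply (delta1_le t u); definable_fun
  | |- delta1 (fun e => @?t e isin ?X) => apply (delta1_mem t X); definable_fun
  | |- delta1 _ =>
      match goal with
      | |- delta1 (fun e => ?p (@?t e) (@?u e)) =>
          apply (delta1_pred2 p t u);
          [solve [eauto with definable]|definable_fun|definable_fun]
      | |- delta1 (fun e => ?p (@?t e)) =>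
          apply (delta1_pred1 p t); [solve [eauto with definable]|definable_fun]
      end
  | |- sigma1 (fun e => @?p e /\ @?q e) =>
      first [ apply delta1_sigma1; definable
            | apply (sigma1_and p q); definable ]
  | |- sigma1 (fun e => @?p e \/ @?q e) =>
      first [ apply delta1_sigma1; definable
            | apply (sigma1_or p q); definable ]
  | |- sigma1 (fun e => forall n, n < @?t e -> @?p e n) =>
      apply (sigma1_all_lt t (fun n e => p e n)); [definable_fun|definable]
  | |- sigma1 (fun e => exists n, @?p e n) =>
      apply (sigma1_ex (fun n e => p e n)); definable
  | |- sigma1 (fun e => ~ @?p e) => apply delta1_sigma1; definable
  | |- sigma1 (fun e => @?p e -> @?q e) => apply (sigma1_imp p q); definable
  | |- sigma1 _ =>
      first [ apply delta1_sigma1; definable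
            | match goal with
              | |- sigma1 (fun e => ?p (@?t e) (@?u e)) =>
                  apply (sigma1_pred2 p t u);
                  [solve [eauto with definable]|definable_fun|definable_fun]
              | |- sigma1 (fun e => ?p (@?t e)) =>
                  apply (sigma1_pred1 p t);
                  [solve [eauto with definable]|definable_fun]
              end ]
  | |- delta1_fun _ => definable_fun
  end.

Create HintDb definable.

(** * Least numbers, pairs and codes of finite sets *)

Section Numbers.

Context {M : L2structure} {hM : RCA0 M}.
Local Notation N := (num M).

Add Ring num_ring_numbers : (@num_semi_ring M hM).

(** A bound [w] on both the value [n] and its Sigma-1 witness [m] reduces the claim to
    [bdd_bounding]. *)
Lemma sigma1_bounding (q : N -> N -> Prop) k :
  sigma1 (fun e => q (e O) (e 1%nat)) ->
  (forall i, i < k -> exists n, q n i) ->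
  exists b, forall i, i < k -> exists n, n < b /\ q n i.
Proof.
  intros (r & Hr & E) H.
  destruct (bdd_bounding (fun w i => exists n, n < w /\ exists m, m < w /\
    r (scons m (scons n (scons i (fun _ => 0))))) k) as [b Hb].
  - apply (bdd_ex (fun e => e O) (fun e => exists m, m < e 1%nat /\
      r (scons m (scons (e O) (scons (e 2%nat) (fun _ => 0)))))); [poly|].
    apply (bdd_ex (fun e => e 1%nat) (fun e =>
      r (scons (e O) (scons (e 1%nat) (scons (e 3%nat) (fun _ => 0)))))); [poly|].
    apply (bdd_ext (fun e => r (fun i => match i with
      | O => e O | 1%nat => e 1%nat | 2%nat => e 3%nat | _ => 0 end))).
    { apply (bdd_subst r (fun i e => match i with
      | O => e O | 1%nat => e 1%nat | 2%nat => e 3%nat | _ => 0 end) Hr).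
      intros [|[|[|i]]]; poly. }
    intros e.
    replace (scons (e O) (scons (e 1%nat) (scons (e 3%nat) (fun _ => 0))))
      with (fun i => match i with
      | O => e O | 1%nat => e 1%nat | 2%nat => e 3%nat | _ => 0 end);
      [reflexivity|].
    apply functional_extensionality; intros [|[|[|i]]]; reflexivity.
  - intros i Hi. destruct (H i Hi) as [n Hn].
    apply (E (scons n (scons i (fun _ => 0)))) in Hn. destruct Hn as [m Hm].
    exists (n + m + 1), n. split; [apply num_lt_iff; now exists m|].
    exists m. split; [apply num_lt_iff; exists n; ring|assumption].
  - exists b. intros i Hi.
    destruct (Hb i Hi) as (w & Hw & n & Hn & m & Hm & Hr').
    exists n. split; [ord|].
    apply (E (scons n (scons i (fun _ => 0)))). now exists m.
Qed.

(** If [p] failed at [a], Sigma-1 induction on [j] would carry the failure down to [a - j], and so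
    to 0. *)
Lemma pi1_induction (p : N -> Prop) :
  sigma1 (fun e => ~ p (e O)) ->
  p 0 -> (forall n, p n -> p (n + 1)) -> forall n, p n.
Proof.
  intros Hp H0 HS a. apply NNPP; intros Ha.
  pose (r n := ~ p n). change (sigma1 (fun e => r (e O))) in Hp.
  assert (K : forall j, le j a -> exists x, x + j = a /\ r x).
  { refine (sigma1_induction (fun j => le j a -> exists x, x + j = a /\ r x)
      _ _ _).
    - definable.
    - intros _. exists a. split; [ring|exact Ha].
    - intros j IH Hj. destruct IH as (x & E & Hx); [ord|].
      destruct (num_zero_or_succ x) as [->|[y ->]]; [now destruct Hx|].
      exists y. split; [rewrite <- E; ring|].
      intros C. now apply Hx, HS. }
  destruct (K a (num_le_refl a)) as (x & E & Hx). apply Hx.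
  rewrite <- (num_add_0_l a) in E at 2. apply num_add_cancel in E.
  now rewrite E.
Qed.

Lemma delta1_induction (p : N -> Prop) :
  delta1 (fun e => p (e O)) ->
  p 0 -> (forall n, p n -> p (n + 1)) -> forall n, p n.
Proof. intros [Hp _]. now apply sigma1_induction. Qed.

(** If there were no least one, Pi-1 induction on [n] would exclude all [i < n]. *)
Lemma sigma1_least (p : N -> Prop) a :
  sigma1 (fun e => p (e O)) -> p a ->
  exists m, p m /\ forall i, i < m -> ~ p i.
Proof.
  intros Hp Ha. apply NNPP; intros C.
  assert (K : forall n, forall i, i < n -> ~ p i).
  { refine (pi1_induction (fun n => forall i, i < n -> ~ p i) _ _ _).
    - apply (sigma1_ext (fun e => exists i, i < e O /\ p i)); [definable|].
      intros e; split.
      + intros (i & Hi & Hpi) H. exact (H i Hi Hpi).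
      + intros H. apply NNPP; intros K. apply H. intros i Hi Hpi.
        apply K. now exists i.
    - intros i Hi; ord.
    - intros n IH i Hi Hpi. apply num_lt_succ in Hi.
      destruct Hi as [Hi| ->]; [now apply (IH i)|].
      apply C. exists n. now split. }
  exact (K (a + 1) a (num_lt_add1 a) Ha).
Qed.

(** [g x] is the least witness. The description operator only names it; its graph is Delta-1 because
    minimality is a bounded condition. *)
Lemma delta1_choice (q : N -> N -> Prop) :
  delta1 (fun e => q (e O) (e 1%nat)) -> (forall x, exists y, q x y) ->
  exists g, delta1_fun (fun e => g (e O)) /\ forall x, q x (g x).
Proof.
  intros Hq H.
  assert (K : forall x, exists y, q x y /\ forall z, z < y -> ~ q x z).
  { intros x. destruct (H x) as [y Hy].
    apply (sigma1_least (q x) y); [definable|assumption]. }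
  pose (g x := proj1_sig (constructive_indefinite_description _ (K x))).
  assert (G : forall x, q x (g x) /\ forall z, z < g x -> ~ q x z).
  { intros x. exact (proj2_sig (constructive_indefinite_description _ (K x))). }
  exists g. split; [|intros x; apply G].
  apply (delta1_ext (fun e => q (e 1%nat) (e O) /\
    forall z, z < e O -> ~ q (e 1%nat) z)); [definable|].
  intros e; split.
  - intros [H1 H2]. destruct (G (e 1%nat)) as [H3 H4].
    destruct (num_lt_total (e O) (g (e 1%nat))) as [L|[L|L]]; [|assumption|].
    + now destruct (H4 _ L).
    + now destruct (H2 _ L).
  - intros E. rewrite E. apply G.
Qed.

(** Pairs of sum [s] take values from [s * s] to [s * s + s], all below [(s + 1) * (s + 1)]. *)
Lemma pair_lt (m n m' n' : N) : m + n < m' + n' -> pair m n < pair m' n'.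
Proof.
  intros [k H]%num_lt_iff. apply num_lt_iff. unfold pair. rewrite H.
  exists ((m + n) * (k + 1) + (m + n) * k + n + k * k + k + k + m'). ring.
Qed.

Lemma pair_inj (m n m' n' : N) : pair m n = pair m' n' -> m = m' /\ n = n'.
Proof.
  intros H. destruct (num_lt_total (m + n) (m' + n')) as [L|[L|L]].
  - apply pair_lt in L. rewrite H in L. ord.
  - unfold pair in H. rewrite L in H.
    rewrite !(num_add_comm ((m' + n') * (m' + n'))) in H.
    apply num_add_cancel in H. subst m'. split; [reflexivity|].
    rewrite !(num_add_comm m) in L. now apply num_add_cancel in L.
  - apply pair_lt in L. rewrite H in L. ord.
Qed.

Lemma pair_le (m n m' n' : N) :
  le m m' -> le n n' -> le (pair m n) (pair m' n').
Proof.
  rewrite !num_le_iff. intros [i ->] [j ->]. unfold pair.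
  exists ((m + n) * (i + j) + (i + j) * (m + n + i + j) + i). ring.
Qed.

Lemma le_pair_l (m n : N) : le m (pair m n).
Proof. apply num_le_iff. exists ((m + n) * (m + n)). unfold pair; ring. Qed.

Lemma le_pair_r (m n : N) : le n (pair m n).
Proof.
  destruct (num_zero_or_succ n) as [->|[j ->]]; [apply num_0_le|].
  apply num_le_iff. exists ((m + j) * (m + j + 1) + m + m). unfold pair; ring.
Qed.

(** Both components are at most the pair, so the search is bounded. Numbers that are not pairs
    satisfy the relation vacuously. *)
Lemma pfst_exists : exists g : N -> N,
  delta1_fun (fun e => g (e O)) /\ forall x y, g (pair x y) = x.
Proof.
  destruct (delta1_choice (fun p x => (exists a, a < p + 1 /\ exists b,
    b < p + 1 /\ p = pair a b) -> exists b, b < p + 1 /\ p = pair x b))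
    as (g & Hg & H).
  - definable.
  - intros p. destruct (classic (exists a, a < p + 1 /\ exists b,
      b < p + 1 /\ p = pair a b)) as [(a & _ & b & Hb & E)|C].
    + exists a. intros _. now exists b.
    + exists 0. tauto.
  - exists g. split; [assumption|]. intros x y.
    destruct (H (pair x y)) as (b & _ & E).
    + exists x. split; [apply num_lt_succ_iff_le, le_pair_l|].
      exists y. split; [apply num_lt_succ_iff_le, le_pair_r|reflexivity].
    + apply pair_inj in E. now symmetry.
Qed.

Lemma psnd_exists : exists g : N -> N,
  delta1_fun (fun e => g (e O)) /\ forall x y, g (pair x y) = y.
Proof.
  destruct (delta1_choice (fun p y => (exists a, a < p + 1 /\ exists b,
    b < p + 1 /\ p = pair a b) -> exists a, a < p + 1 /\ p = pair a y))
    as (g & Hg & H).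
  - definable.
  - intros p. destruct (classic (exists a, a < p + 1 /\ exists b,
      b < p + 1 /\ p = pair a b)) as [(a & Ha & b & _ & E)|C].
    + exists b. intros _. now exists a.
    + exists 0. tauto.
  - exists g. split; [assumption|]. intros x y.
    destruct (H (pair x y)) as (b & _ & E).
    + exists x. split; [apply num_lt_succ_iff_le, le_pair_l|].
      exists y. split; [apply num_lt_succ_iff_le, le_pair_r|reflexivity].
    + apply pair_inj in E. now symmetry.
Qed.

Definition pfst : N -> N :=
  proj1_sig (constructive_indefinite_description _ pfst_exists).

Definition psnd : N -> N :=
  proj1_sig (constructive_indefinite_description _ psnd_exists).

Lemma delta1_fun_pfst : delta1_fun (fun e => pfst (e O)).
Proof. apply (proj2_sig (constructive_indefinite_description _ pfst_exists)). Qed.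

Lemma delta1_fun_psnd : delta1_fun (fun e => psnd (e O)).
Proof. apply (proj2_sig (constructive_indefinite_description _ psnd_exists)). Qed.

Lemma pfst_pair x y : pfst (pair x y) = x.
Proof. apply (proj2_sig (constructive_indefinite_description _ pfst_exists)). Qed.

Lemma psnd_pair x y : psnd (pair x y) = y.
Proof. apply (proj2_sig (constructive_indefinite_description _ psnd_exists)). Qed.

End Numbers.

#[export] Hint Resolve delta1_fun_pfst delta1_fun_psnd : definable.

(** * Finite sets coded by divisibility *)

Section Codes.

Context {M : L2structure} {hM : RCA0 M}.
Local Notation N := (num M).

Add Ring num_ring_codes : (@num_semi_ring M hM).

(** Numbers that are not pairs are excluded from [R], which later gives [subset_prod]. *)
Lemma delta1_relation_comprehension (q : N -> N -> Prop) :
  delta1 (fun e => q (e O) (e 1%nat)) ->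
  exists R : sets M, (forall x y, pair x y isin R <-> q x y) /\
    (forall p, p isin R -> exists x y, p = pair x y).
Proof.
  intros Hq.
  destruct (delta1_comprehension
    (fun p => p = pair (pfst p) (psnd p) /\ q (pfst p) (psnd p))) as [R HR].
  - definable.
  - exists R. split.
    + intros x y. rewrite HR, pfst_pair, psnd_pair. tauto.
    + intros p Hp. apply HR in Hp. exists (pfst p), (psnd p). tauto.
Qed.

Definition divides (d z : N) : Prop := exists q, z = d * q.

Lemma divides_mul_r d z k : divides d z -> divides d (z * k).
Proof. intros [q ->]. exists (q * k). ring. Qed.

Lemma divides_add_cancel d x y :
  divides d x -> divides d (x + y) -> divides d y.
Proof.
  intros [q ->] [r H].
  destruct (classic (q < r)) as [L|L].
  - apply num_lt_iff in L. destruct L as [k ->]. exists (k + 1).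
    apply (num_add_cancel (d * q)). rewrite num_add_comm, H. ring.
  - apply num_nlt_le, num_le_iff in L. destruct L as [k ->].
    assert (E : y + d * k = 0).
    { apply (num_add_cancel (d * r)).
      transitivity (d * (r + k) + y); [ring|rewrite H; ring]. }
    exists 0. destruct (num_zero_or_succ y) as [->|[j ->]]; [ring|].
    exfalso. apply (num_succ_neq0 (j + d * k)). rewrite <- E. ring.
Qed.

Definition modulus (m i : N) : N := 1 + (i + 1) * m.

(** A modulus is at least 1, so the quotient is at most [z]; the right-hand side is the bounded form
    used in [incode]. *)
Lemma divides_bound m i z : divides (modulus m i) z <->
  exists q, q < z + 1 /\ z = (1 + (i + 1) * m) * q.
Proof.
  split; [|intros (q & _ & ->); now exists q].
  intros [q ->]. exists q. split; [|reflexivity].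
  apply num_lt_succ_iff_le, num_le_iff. exists ((i + 1) * m * q).
  unfold modulus; ring.
Qed.

(** With [m = (k + 1) * r], the sum of [z * (k + 1) * (r * (i + 1))] and [z] is
    [z * modulus m i]. *)
Lemma modulus_gauss m i z k r :
  m = (k + 1) * r -> divides (modulus m i) (z * (k + 1)) ->
  divides (modulus m i) z.
Proof.
  intros Hm H.
  apply (divides_add_cancel _ (z * (k + 1) * (r * (i + 1)))).
  - now apply divides_mul_r.
  - exists z. rewrite Hm. unfold modulus. ring.
Qed.

(** A combination of the two moduli is [i - j], which divides [m], and [m] is
    prime to every modulus. *)
Lemma modulus_coprime b m i j z :
  (forall k, k < b -> exists r, m = (k + 1) * r) ->
  i < b -> j < b -> i <> j ->
  divides (modulus m i) (z * modulus m j) -> divides (modulus m i) z.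
Proof.
  intros Hm Hi Hj Hij H.
  apply num_lt_neq in Hij. destruct Hij as [L|L];
    apply num_lt_iff in L; destruct L as [k E].
  - assert (Hk : k < b).
    { apply (num_le_lt_trans _ j); [|assumption].
      apply num_le_iff. exists (i + 1). rewrite E; ring. }
    destruct (Hm k Hk) as [r Hr]. apply (modulus_gauss m i z k r Hr).
    (* [(i + 1) * modulus m j + (k + 1) = (j + 1) * modulus m i], since [j = i + k + 1]. *)
    apply (divides_add_cancel _ (z * modulus m j * (i + 1))).
    + now apply divides_mul_r.
    + exists (z * (j + 1)). unfold modulus. rewrite E. ring.
  - assert (Hk : k < b).
    { apply (num_le_lt_trans _ i); [|assumption].
      apply num_le_iff. exists (j + 1). rewrite E; ring. }
    destruct (Hm k Hk) as [r Hr]. apply (modulus_gauss m i z k r Hr).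
    apply (divides_add_cancel _ (modulus m i * (z * (j + 1)))).
    + now exists (z * (j + 1)).
    + destruct H as [q Hq]. exists (q * (i + 1)).
      transitivity (z * modulus m j * (i + 1)); [|rewrite Hq; ring].
      unfold modulus. rewrite E. ring.
Qed.

(** Sigma-1 induction builds the factorial of [b]; being nonzero, it makes the moduli exceed 1. *)
Lemma common_multiple b : exists m : N, m <> 0 /\
  forall k, k < b -> exists r, m = (k + 1) * r.
Proof.
  revert b. refine (sigma1_induction (fun b => exists m, m <> 0 /\
    forall k, k < b -> exists r, m = (k + 1) * r) _ _ _).
  - definable.
  - exists 1. split; [|intros k Hk; ord].
    intros C. apply (num_succ_neq0 0). now rewrite num_add_0_l.
  - intros b (m & Hm & H). exists (m * (b + 1)). split.
    + destruct (num_zero_or_succ m) as [->|[j ->]]; [now destruct Hm|].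
      intros C. apply (num_succ_neq0 (j * (b + 1) + b)). rewrite <- C. ring.
    + intros k Hk. apply num_lt_succ in Hk. destruct Hk as [Hk| ->].
      * destruct (H k Hk) as [r ->]. exists (r * (b + 1)). ring.
      * exists m. ring.
Qed.

(** [c = pair m z] codes the set of the [i] such that [1 + (i + 1) m] divides
    [z], as in Goedel's beta function. *)
Definition incode (c i : N) : Prop :=
  exists q, q < psnd c + 1 /\ psnd c = (1 + (i + 1) * pfst c) * q.

Lemma delta1_incode : delta1 (fun e => incode (e O) (e 1%nat)).
Proof. unfold incode. definable. Qed.

(** The code is the product of the moduli of the members below [c], built by induction on [c]. By
    [modulus_coprime] a new factor affects the membership of [c] only. *)
Lemma code_exists (p : N -> Prop) b : delta1 (fun e => p (e O)) ->
  exists c, forall i, i < b -> (incode c i <-> p i).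
Proof.
  intros Hp. destruct (common_multiple b) as (m & Hm0 & Hm).
  assert (K : forall c, exists z, forall i, i < b ->
    ((exists q, q < z + 1 /\ z = (1 + (i + 1) * m) * q) <-> i < c /\ p i)).
  { refine (sigma1_induction (fun c => exists z, forall i, i < b ->
      ((exists q, q < z + 1 /\ z = (1 + (i + 1) * m) * q) <-> i < c /\ p i))
      _ _ _).
    - apply sigma1_ex. apply delta1_sigma1. definable.
    (* The empty product: no modulus divides 1, because [m] is not 0. *)
    - exists 1. intros i Hi. split; [|intros [C _]; ord].
      intros (q & _ & E). exfalso.
      destruct (num_zero_or_succ m) as [->|[m' ->]]; [now apply Hm0|].
      destruct (num_zero_or_succ q) as [->|[r ->]].
      + apply (num_succ_neq0 0). rewrite num_add_0_l, E. ring.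
      + apply (num_succ_neq0 (r + (i * m' + i + m') * (r + 1) + r)).
        apply (num_add_cancel 1).
        transitivity ((1 + (i + 1) * (m' + 1)) * (r + 1)); [ring|].
        rewrite <- E. ring.
    - intros c (z & Hz).
      destruct (classic (c < b /\ p c)) as [[Hc Hpc]|C].
      + exists (z * modulus m c). intros i Hi.
        rewrite <- divides_bound.
        destruct (classic (i = c)) as [->|Hic].
        * split; [intros _; split; [apply num_lt_add1|assumption]|].
          intros _. exists z. ring.
        * specialize (Hz i Hi). rewrite <- divides_bound in Hz.
          assert (E : i < c + 1 <-> i < c).
          { rewrite num_lt_succ. tauto. }
          rewrite E, <- Hz. split.
          -- now apply (modulus_coprime b).
          -- apply divides_mul_r.
      + exists z. intros i Hi. rewrite (Hz i Hi), num_lt_succ. split; [tauto|].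
        intros [[H| ->] Hpi]; tauto. }
  destruct (K b) as [z Hz]. exists (pair m z). intros i Hi.
  unfold incode. rewrite pfst_pair, psnd_pair, (Hz i Hi). tauto.
Qed.

End Codes.

#[export] Hint Resolve delta1_incode : definable.

(** * Recursion, pigeonhole principle and comprehension *)

Section Recursion.

Context {M : L2structure} {hM : RCA0 M}.
Local Notation N := (num M).

Add Ring num_ring_recursion : (@num_semi_ring M hM).

(** [c] codes a set of pairs containing [(n, v)], in which each pair [(i, x)] with [i <= n] and
    [x < b] is either [(0, a)] or justified by a pair [(i - 1, y)] of the set with [x = g y]. That
    values are unique is proved inside [recursion]. *)
Definition approximation (g : N -> N) (a c b n v : N) : Prop :=
  v < b /\ incode c (pair n v) /\
  forall i, i < n + 1 -> forall x, x < b -> incode c (pair i x) ->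
    i = 0 /\ x = a \/
    exists j, j < i /\ exists y, y < b /\
      i = j + 1 /\ incode c (pair j y) /\ x = g y.

(** The pairs up to [n] are copied, the pair [(n + 1, g v)] is added, and [b'] bounds the old and
    the new values. *)
Lemma approximation_step g a c b n v :
  delta1_fun (fun e => g (e O)) ->
  approximation g a c b n v ->
  exists c' b', approximation g a c' b' (n + 1) (g v).
Proof.
  intros Hg (Hv & Hc & H).
  pose (b' := b + g v + 1).
  pose (p x := (exists i, i < n + 1 /\ exists y, y < b /\
                 x = pair i y /\ incode c x) \/ x = pair (n + 1) (g v)).
  destruct (code_exists p (pair (n + 1) b' + 1)) as [c' Hc'].
  { unfold p. definable. }
  assert (Hb : le b b').
  { apply num_le_iff. exists (g v + 1). unfold b'; ring. }
  assert (Hgv : g v < b').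
  { apply num_lt_iff. exists b. unfold b'; ring. }
  assert (Hn : n < n + 1) by apply num_lt_add1.
  assert (K : forall i y, i < n + 1 -> y < b ->
                incode c (pair i y) -> incode c' (pair i y)).
  { intros i y Hi Hy Hiy. apply Hc'.
    - apply num_lt_succ_iff_le, pair_le; ord.
    - left. exists i. split; [assumption|]. now exists y. }
  exists c', b'. repeat split; [assumption| |].
  - apply Hc'; [|now right].
    apply num_lt_succ_iff_le, pair_le; [apply num_le_refl|ord].
  - intros i Hi x Hx Hix. apply Hc' in Hix.
    2:{ apply num_lt_succ_iff_le, pair_le; ord. }
    destruct Hix as [(i' & Hi' & y & Hy & E & Hiy)|E].
    + apply pair_inj in E. destruct E as [<- <-].
      destruct (H i Hi' x Hy Hiy) as [E|(j & Hj & z & Hz & E & Hjz & E')];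
        [now left|right].
      exists j. split; [assumption|]. exists z. repeat split; try assumption.
      * ord.
      * apply K; try assumption. ord.
    + apply pair_inj in E. destruct E as [-> ->]. right.
      exists n. split; [assumption|]. exists v. repeat split.
      * ord.
      * now apply K.
Qed.

(** The graph [H] is Sigma-1; it is total by Sigma-1 induction and single-valued by Pi-1
    induction. *)
Lemma recursion (g : N -> N) a : delta1_fun (fun e => g (e O)) ->
  exists h, delta1_fun (fun e => h (e O)) /\ h 0 = a /\
    forall n, h (n + 1) = g (h n).
Proof.
  intros Hg.
  pose (H n v := exists c b, approximation g a c b n v).
  assert (DH : sigma1 (fun e => H (e O) (e 1%nat))).
  { unfold H, approximation. definable. }
  assert (H0 : H 0 a).
  { destruct (code_exists (fun x => x = pair 0 a) (pair 0 a + 1)) as [c Hc];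
      [definable|].
    exists c, (a + 1). repeat split; [apply num_lt_add1| |].
    - apply Hc; [apply num_lt_add1|reflexivity].
    - intros i Hi x Hx Hix. left. apply Hc, pair_inj in Hix; [assumption|].
      apply num_lt_succ_iff_le, pair_le; ord. }
  assert (HS : forall n v, H n v -> H (n + 1) (g v)).
  { intros n v (c & b & Hcb). exact (approximation_step g a c b n v Hg Hcb). }
  assert (H0' : forall v, H 0 v -> v = a).
  { intros v (c & b & Hv & Hc & K).
    destruct (K 0 (num_lt_add1 0) v Hv Hc) as [[_ E]|(j & Hj & _)];
      [assumption|ord]. }
  assert (HS' : forall n v, H (n + 1) v -> exists y, H n y /\ v = g y).
  { intros n v (c & b & Hv & Hc & K).
    destruct (K (n + 1) (num_lt_add1 _) v Hv Hc)
      as [[E _]|(j & Hj & y & Hy & E & Hjy & E')].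
    - now apply num_succ_neq0 in E.
    - apply num_add_cancel in E. subst j. exists y. split; [|assumption].
      exists c, b. repeat split; try assumption.
      intros i Hi. apply K. ord. }
  assert (T : forall n, exists v, H n v).
  { refine (sigma1_induction (fun n => exists v, H n v) _ _ _).
    - definable.
    - now exists a.
    - intros n [v Hv]. exists (g v). now apply HS. }
  assert (U : forall n v, H n v -> forall w, H n w -> v = w).
  { intros n v Hv w Hw. apply NNPP; intros C.
    cut (~ exists v w, v <> w /\ H n v /\ H n w).
    { intros K; apply K. now exists v, w. }
    clear v w Hv Hw C. revert n.
    refine (pi1_induction (fun n => ~ exists v w, v <> w /\ H n v /\ H n w)
      _ _ _).
    - apply (sigma1_ext (fun e => exists v w, v <> w /\ H (e O) v /\ H (e O) w));
        [definable|]. intros e; split; [tauto|apply NNPP].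
    - intros (v & w & C & Hv & Hw). apply C.
      now rewrite (H0' v Hv), (H0' w Hw).
    - intros n IH (v & w & C & Hv & Hw).
      destruct (HS' n v Hv) as (v' & Hv' & ->).
      destruct (HS' n w Hw) as (w' & Hw' & ->).
      apply IH. exists v', w'. split; [congruence|now split]. }
  pose (h n := proj1_sig (constructive_indefinite_description _ (T n))).
  assert (Hh : forall n, H n (h n)).
  { intros n. exact (proj2_sig (constructive_indefinite_description _ (T n))). }
  exists h. repeat split.
  - apply (sigma1_ext (fun e => H (e 1%nat) (e O))); [definable|].
    intros e; split; [|intros ->; apply Hh].
    intros K. exact (U _ _ K _ (Hh _)).
  (* Off the graph another value is attained, which makes the complement Sigma-1. *)
  - apply (sigma1_ext (fun e => exists v, v <> e O /\ H (e 1%nat) v));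
      [definable|].
    intros e; split.
    + intros (v & Hv & K) E. apply Hv. rewrite E. exact (U _ _ K _ (Hh _)).
    + intros K. exists (h (e 1%nat)). split; [congruence|apply Hh].
  - apply H0', Hh.
  - intros n. exact (U _ _ (Hh _) _ (HS _ _ (Hh n))).
Qed.

(** Pi-1 induction on [k] over all codes at once: a total injective relation from [k + 2] to [k + 1]
    elements is cut down to one from [k + 1] to [k]. *)
Lemma pigeonhole_code (k c : N) :
  (forall i, i < k + 1 -> exists y, y < k /\ incode c (pair i y)) ->
  (forall i, i < k + 1 -> forall j, j < k + 1 -> forall y, y < k ->
     incode c (pair i y) -> incode c (pair j y) -> i = j) ->
  False.
Proof.
  cut (~ exists c,
    (forall i, i < k + 1 -> exists y, y < k /\ incode c (pair i y)) /\
    (forall i, i < k + 1 -> forall j, j < k + 1 -> forall y, y < k ->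
       incode c (pair i y) -> incode c (pair j y) -> i = j)).
  { intros C H1 H2. apply C. exists c. now split. }
  clear c. revert k. refine (pi1_induction (fun k => ~ exists c,
    (forall i, i < k + 1 -> exists y, y < k /\ incode c (pair i y)) /\
    (forall i, i < k + 1 -> forall j, j < k + 1 -> forall y, y < k ->
       incode c (pair i y) -> incode c (pair j y) -> i = j)) _ _ _).
  - apply (sigma1_ext (fun e => exists c,
      (forall i, i < e O + 1 -> exists y, y < e O /\ incode c (pair i y)) /\
      (forall i, i < e O + 1 -> forall j, j < e O + 1 -> forall y, y < e O ->
         incode c (pair i y) -> incode c (pair j y) -> i = j)));
      [definable|].
    intros e; split; [tauto|apply NNPP].
  - intros (c & H & _). destruct (H 0 (num_lt_add1 0)) as (y & Hy & _). ord.
  - intros k IH (c & HT & HI).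
    destruct (HT (k + 1) (num_lt_add1 _)) as (y0 & Hy0 & Hc0).
    (* What [c] sends to [k] is redirected to [y0], the value freed by dropping the argument
       [k + 1]. *)
    pose (p x := exists i, i < k + 1 /\ exists y, y < k /\ x = pair i y /\
      (incode c (pair i y) \/ y = y0 /\ incode c (pair i k))).
    destruct (code_exists p (pair (k + 1) k + 1)) as [c' Hc'].
    { unfold p. definable. }
    assert (K : forall i y, i < k + 1 -> y < k ->
      (incode c' (pair i y) <->
       incode c (pair i y) \/ y = y0 /\ incode c (pair i k))).
    { intros i y Hi Hy. rewrite Hc'.
      2:{ apply num_lt_succ_iff_le, pair_le; ord. }
      split.
      - intros (i' & Hi' & y' & Hy' & E & H).
        apply pair_inj in E. destruct E as [-> ->]. assumption.
      - intros H. exists i. split; [assumption|]. exists y. now repeat split. }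
    assert (L : k < k + 1 + 1) by (apply num_lt_succ_iff_le; left; apply num_lt_add1).
    assert (L' : k + 1 < k + 1 + 1) by apply num_lt_add1.
    assert (L'' : k < k + 1) by apply num_lt_add1.
    apply IH. exists c'. split.
    + intros i Hi.
      destruct (HT i) as (y & Hy & Hiy); [ord|].
      apply num_lt_succ in Hy. destruct Hy as [Hy| ->].
      * exists y. split; [assumption|]. apply K; auto.
      * exists y0.
        assert (Hy0' : y0 < k).
        { apply num_lt_succ in Hy0. destruct Hy0 as [Hy0| ->]; [assumption|].
          exfalso.
          assert (E : i = k + 1) by (apply (HI i ltac:(ord) _ L' k); assumption).
          ord. }
        split; [assumption|]. apply K; auto.
    + intros i Hi j Hj y Hy Hiy Hjy. apply K in Hiy, Hjy; try assumption.
      assert (L1 : forall i, i < k + 1 -> i < k + 1 + 1) by (intros; ord).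
      assert (F : forall i, i < k + 1 -> ~ incode c (pair i y0)).
      { intros i' Hi' C.
        assert (E : i' = k + 1) by (apply (HI i' ltac:(ord) _ L' y0); assumption).
        ord. }
      destruct Hiy as [Hiy|[-> Hiy]], Hjy as [Hjy|[E Hjy]].
      * apply (HI i ltac:(ord) j ltac:(ord) y); auto. ord.
      * subst y. now destruct (F i Hi).
      * now destruct (F j Hj).
      * apply (HI i ltac:(ord) j ltac:(ord) k); auto.
Qed.

Lemma pigeonhole (q : N -> N -> Prop) k :
  delta1 (fun e => q (e O) (e 1%nat)) ->
  (forall i, i < k + 1 -> exists y, y < k /\ q i y) ->
  exists i j y, i < j /\ j < k + 1 /\ q i y /\ q j y.
Proof.
  intros Hq HT. apply NNPP; intros C.
  destruct (code_exists (fun x => q (pfst x) (psnd x)) (pair (k + 1) k + 1))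
    as [c Hc]; [definable|].
  assert (K : forall i y, i < k + 1 -> y < k ->
    (incode c (pair i y) <-> q i y)).
  { intros i y Hi Hy. rewrite Hc, pfst_pair, psnd_pair; [reflexivity|].
    apply num_lt_succ_iff_le, pair_le; ord. }
  apply (pigeonhole_code k c).
  - intros i Hi. destruct (HT i Hi) as (y & Hy & Hqy).
    exists y. split; [assumption|]. now apply K.
  - intros i Hi j Hj y Hy Hiy Hjy. apply K in Hiy, Hjy; try assumption.
    apply NNPP; intros D. apply num_lt_neq in D.
    destruct D as [D|D]; apply C; [exists i, j|exists j, i]; exists y; auto.
Qed.

(** Otherwise all [h (a + i)] would lie below [b], against the pigeonhole principle. *)
Lemma injective_unbounded (h : N -> N) a b :
  delta1_fun (fun e => h (e O)) -> (forall i j, h i = h j -> i = j) ->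
  exists j, le a j /\ le b (h j).
Proof.
  intros Hh HI. apply NNPP; intros C.
  destruct (pigeonhole (fun i y => h (a + i) = y) b)
    as (i & j & y & Hij & _ & Hi & Hj).
  - definable.
  - intros i _. exists (h (a + i)). split; [|reflexivity].
    apply num_nle_lt. intros L. apply C. exists (a + i).
    split; [apply num_le_iff; now exists i|assumption].
  - rewrite <- Hj in Hi. apply HI in Hi.
    rewrite !(num_add_comm a) in Hi. apply num_add_cancel in Hi. ord.
Qed.

Lemma infinite_unbounded (X : sets M) k :
  infinite X -> exists i, i isin X /\ k < i.
Proof.
  intros H. apply NNPP; intros C. apply H. exists (k + 1). intros i Hi.
  apply num_lt_succ_iff_le, num_nlt_le. intros L. apply C. now exists i.
Qed.

(** A larger element of [X] is chosen again and again; the sequence need not exhaust [X]. *)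
Lemma infinite_enumeration (X : sets M) : infinite X ->
  exists h, delta1_fun (fun e => h (e O)) /\ (forall n, h n isin X) /\
    forall i j, i < j -> h i < h j.
Proof.
  intros HX.
  destruct (delta1_choice (fun x y => y isin X /\ x < y)) as (g & Hg & G).
  - definable.
  - intros x. now apply infinite_unbounded.
  - destruct (recursion g (g 0) Hg) as (h & Hh & H0 & HS).
    exists h. split; [assumption|]. split.
    + intros n. destruct (num_zero_or_succ n) as [->|[k ->]].
      * rewrite H0. apply G.
      * rewrite HS. apply G.
    + intros i. refine (delta1_induction (fun j => i < j -> h i < h j) _ _ _).
      * definable.
      * intros C; ord.
      * intros j IH Hj. rewrite HS. destruct (G (h j)) as [_ L].
        apply num_lt_succ in Hj. destruct Hj as [Hj| ->]; [|assumption].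
        specialize (IH Hj). ord.
Qed.

End Recursion.

(** * Sigma-1 comprehension and arithmetical comprehension *)

Section Comprehension.

Context {M : L2structure} {hM : RCA0 M}.
Local Notation N := (num M).
Local Notation env := (nat -> num M).

Definition sigma1_comprehension : Prop :=
  forall p : N -> Prop, sigma1 (fun e => p (e O)) ->
  exists X : sets M, forall n, n isin X <-> p n.

Lemma bounded_arithmetical f : bounded f -> arithmetical f.
Proof. induction 1; simpl; auto. Qed.

Lemma ACA0_sigma1_comprehension : ACA0 M -> sigma1_comprehension.
Proof.
  intros (_ & _ & H) p (f & e & E & [f' Hf] & G)%sigma1_formula.
  destruct (H (FExN f')) with (e := e) (E := E) as [X HX].
  - exact (bounded_arithmetical f' Hf).
  - exists X. intros n. now rewrite HX.
Qed.

Definition depends (d : nat) (p : env -> Prop) : Prop :=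
  forall e e', (forall i, (i < d)%nat -> e i = e' i) -> p e -> p e'.

Lemma bdd_depends (p : env -> Prop) : bdd p -> exists d, depends d p.
Proof.
  intros Hp. destruct (bdd_formula p Hp) as (d & l & a & L & A & H).
  destruct (H d O O (le_n d)) as (f & _ & F).
  exists d. intros e e' Hee He.
  apply (F e' a A); [intros i _; reflexivity|intros i _; reflexivity|].
  replace (stack d e' a) with (stack d e a).
  - apply F; [intros i _; reflexivity|intros i _; reflexivity|assumption].
  - apply functional_extensionality; intros i. unfold stack.
    destruct (Nat.ltb_spec i d); auto.
Qed.

(** The variables are packed into one by iterated pairing. *)
Lemma sigma1_depends_bdd d (p : env -> Prop) :
  sigma1_comprehension -> sigma1 p -> depends (S d) p -> bdd p.
Proof.
  intros SC. revert p; induction d as [|d IH]; intros p Hp Hd.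
  - destruct (SC (fun n => p (scons n (fun _ => 0)))) as [X HX].
    { apply (sigma1_ext (fun e => p (fun i => match i with
        | O => e O | _ => 0 end))).
      - apply (sigma1_subst p (fun i e => match i with
          | O => e O | _ => 0 end) Hp). intros [|i]; poly.
      - intros e.
        replace (scons (e O) (fun _ => 0)) with
          (fun i => match i with O => e O | _ => 0 end); [reflexivity|].
        apply functional_extensionality; intros [|i]; reflexivity. }
    apply (bdd_ext (fun e => e O isin X)).
    { apply (bdd_in (fun e => e O)); poly. }
    intros e. rewrite HX. split; apply Hd; intros [|i] Hi; (reflexivity || lia).
  - pose (p' e := p (scons (pfst (e O)) (scons (psnd (e O))
                                               (fun i => e (S i))))).
    assert (Hp' : bdd p').
    { apply IH.
      - unfold p'.
        apply (sigma1_let (fun a e => p (scons a (scons (psnd (e O))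
                                                        (fun i => e (S i)))))
                 (fun e => pfst (e O))); [definable_fun|].
        apply (sigma1_let (fun a e => p (scons (e O) (scons a
                                                        (fun i => e (S (S i))))))
                 (fun e => psnd (e 1%nat))); [definable_fun|].
        apply (sigma1_ext (fun e => p (fun i => match i with
          | O => e 1%nat | S O => e O | S (S j) => e (S (S (S j))) end))).
        + apply (sigma1_subst p (fun i e => match i with
            | O => e 1%nat | S O => e O | S (S j) => e (S (S (S j))) end) Hp).
          intros [|[|i]]; poly.
        + intros e.
          replace (scons (e 1%nat) (scons (e O) (fun i => e (S (S (S i))))))
            with (fun i => match i with
              | O => e 1%nat | S O => e O | S (S j) => e (S (S (S j))) end);
            [reflexivity|].
          apply functional_extensionality; intros [|[|i]]; reflexivity.
      - intros e e' H. unfold p'. apply Hd. intros [|[|i]] Hi; simpl.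
        + now rewrite H by lia.
        + now rewrite H by lia.
        + apply H; lia. }
    apply (bdd_ext (fun e => p' (fun i => match i with
      | O => pair (e O) (e 1%nat) | S j => e (S (S j)) end))).
    + apply (bdd_subst p' (fun i e => match i with
        | O => pair (e O) (e 1%nat) | S j => e (S (S j)) end) Hp').
      intros [|i]; unfold pair; poly.
    + intros e. unfold p'. rewrite pfst_pair, psnd_pair.
      split; apply Hd; intros [|[|i]]; reflexivity.
Qed.

(** The matrix of [p] depends on finitely many variables, hence so does [p], as [sigma1_depends_bdd]
    requires. *)
Lemma sigma1_bdd (p : env -> Prop) : sigma1_comprehension -> sigma1 p -> bdd p.
Proof.
  intros SC Hp. pose proof Hp as (q & Hq & E).
  destruct (bdd_depends q Hq) as [d Hd].
  apply (sigma1_depends_bdd d p SC Hp).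
  intros e e' H He. apply E. apply E in He. destruct He as [n Hn]. exists n.
  revert Hn. apply Hd. intros [|i] Hi; [reflexivity|]. apply H; lia.
Qed.

Lemma eval_polynomial t : polynomial (fun e : env => eval e t).
Proof. induction t; simpl; now constructor. Qed.

(** A number quantifier over a bounded relation gives a Sigma-1 relation or the negation of one,
    which [sigma1_bdd] makes bounded again; so the induction on [f] never leaves [bdd]. *)
Lemma arithmetical_bdd f E : sigma1_comprehension -> arithmetical f ->
  bdd (fun e : env => sat e E f).
Proof.
  intros SC.
  assert (X : forall p, bdd p -> bdd (fun e : env => exists n, p (scons n e))).
  { intros p Hp. apply (sigma1_bdd _ SC). exists p. now split. }
  induction f; simpl; intros Hf; try tauto.
  - apply bdd_eq; apply eval_polynomial.
  - apply bdd_lt; apply eval_polynomial.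
  - apply (bdd_in (fun e => eval e t)), eval_polynomial.
  - apply (bdd_not (fun e => sat e E f)); auto.
  - apply bdd_and; tauto.
  - apply bdd_or; tauto.
  - apply bdd_imp; tauto.
  - apply (bdd_ext (fun e => ~ exists n, ~ sat (scons n e) E f)).
    + apply (bdd_not (fun e => exists n, ~ sat (scons n e) E f)).
      apply (X (fun e => ~ sat e E f)), bdd_not; auto.
    + intros e; split.
      * intros H n. apply NNPP; intros C. apply H. now exists n.
      * intros H [n Hn]. apply Hn, H.
  - apply (X (fun e => sat e E f)); auto.
Qed.

Lemma sigma1_comprehension_ACA0 : sigma1_comprehension -> ACA0 M.
Proof.
  intros SC. split; [exact RCA0_basic|]. split.
  - intros X H0 HS.
    refine (delta1_induction (fun n => n isin X) _ H0 HS). definable.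
  - intros f Hf e E. apply delta1_comprehension, bdd_delta1.
    apply (bdd_ext (fun e' => sat (fun i => match i with
      | O => e' O | S j => e j end) E f)).
    + apply (bdd_subst _ (fun i e' => match i with
        | O => e' O | S j => e j end) (arithmetical_bdd f E SC Hf)).
      intros [|i]; poly.
    + intros e'.
      replace (scons (e' O) e) with
        (fun i => match i with O => e' O | S j => e j end); [reflexivity|].
      apply functional_extensionality; intros [|i]; reflexivity.
Qed.

End Comprehension.

(** * From arithmetical comprehension to ideals *)

Section Ideals.

Context {M : L2structure} {hM : RCA0 M}.
Local Notation N := (num M).
Local Notation env := (nat -> num M).

Lemma sigma1_delta1 (p : env -> Prop) :
  @sigma1_comprehension M -> sigma1 p -> delta1 p.
Proof. intros SC Hp. now apply bdd_delta1, sigma1_bdd. Qed.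

Lemma relation_field (P R : sets M) x y :
  subset_prod R (mem P) (mem P) -> pair x y isin R -> x isin P /\ y isin P.
Proof.
  intros H Hxy. destruct (H _ Hxy) as (x' & y' & Hx & Hy & E).
  apply pair_inj in E. destruct E as [-> ->]. now split.
Qed.

Definition compatible (R : sets M) (x y : N) : Prop :=
  exists z, pair x z isin R /\ pair y z isin R.

Definition splits (R : sets M) (x : N) : Prop :=
  exists u v, pair x u isin R /\ pair x v isin R /\ ~ compatible R u v.

Lemma delta1_compatible R : @sigma1_comprehension M ->
  delta1 (fun e => compatible R (e O) (e 1%nat)).
Proof. intros SC. apply sigma1_delta1; [exact SC|]. unfold compatible. definable. Qed.

Lemma delta1_splits R : @sigma1_comprehension M ->
  delta1 (fun e => splits R (e O)).
Proof.
  intros SC. apply sigma1_delta1; [exact SC|].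
  pose proof (delta1_compatible R SC). unfold splits. definable.
Qed.

(** Recursion climbs a chain [h] above [x0]. At each step some [w n] above [h n] is incompatible
    with [h (n + 1)], and hence with every later [w m], which lies above [h (n + 1)]. *)
Lemma splitting_infinite_strong_antichain (P R : sets M) x0 :
  @sigma1_comprehension M -> partial_order P R -> x0 isin P ->
  (forall y, pair x0 y isin R -> splits R y) ->
  exists X, strong_antichain P R X /\ infinite X.
Proof.
  intros SC (Hsub & Hrefl & _ & Htrans) Hx0 Hsplit.
  pose proof (delta1_compatible R SC) as DC.
  (* Stated as an implication so that a total choice function exists; the recursion stays above
     [x0]. *)
  pose (q v v' := pair x0 v isin R -> pair v v' isin R /\
                  exists u, pair v u isin R /\ ~ compatible R u v').
  destruct (delta1_choice q) as (g & Hg & G).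
  { apply sigma1_delta1; [exact SC|]. unfold q. definable. }
  { intros v. unfold q. destruct (classic (pair x0 v isin R)) as [H|H].
    - destruct (Hsplit v H) as (u & v' & H1 & H2 & H3). exists v'. intros _.
      split; [assumption|]. now exists u.
    - exists v. tauto. }
  destruct (recursion g x0 Hg) as (h & Hh & H0 & HS).
  assert (Hx : forall n, pair x0 (h n) isin R).
  { refine (delta1_induction (fun n => pair x0 (h n) isin R) _ _ _).
    - definable.
    - rewrite H0. now apply Hrefl.
    - intros n IH. rewrite HS. apply (Htrans _ _ _ IH), G, IH. }
  assert (Hinc : forall i j, le i j -> pair (h i) (h j) isin R).
  { intros i.
    refine (delta1_induction (fun j => le i j -> pair (h i) (h j) isin R)
      _ _ _).
    - definable.
    - intros Hi. assert (i = 0) as -> by (destruct Hi; [ord|assumption]).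
      apply Hrefl, (relation_field P R x0 _ Hsub), Hx.
    - intros j IH [Hij| ->].
      + rewrite HS. apply (Htrans _ (h j)); [apply IH; ord|apply G, Hx].
      + apply Hrefl, (relation_field P R x0 _ Hsub), Hx. }
  destruct (delta1_choice (fun n u =>
    pair (h n) u isin R /\ ~ compatible R u (h (n + 1)))) as (w & Hw & W).
  { definable. }
  { intros n. destruct (G (h n) (Hx n)) as (_ & u & Hu & C).
    exists u. rewrite HS. now split. }
  assert (Hinj : forall i j z, i < j -> pair (w i) z isin R ->
                   pair (w j) z isin R -> False).
  { intros i j z Hij Hi Hj. destruct (W i) as [_ C]. apply C. exists z.
    split; [assumption|]. apply (Htrans _ (w j)); [|assumption].
    apply (Htrans _ (h j)); [|apply W]. apply Hinc. ord. }
  assert (HwP : forall n, w n isin P).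
  { intros n. destruct (W n) as [K _]. now apply (relation_field P R) in K. }
  (* [w] need not be increasing, so its range is obtained from Sigma-1 comprehension. *)
  destruct (SC (fun x => exists n, x = w n)) as [X HX]; [definable|].
  exists X. repeat split.
  - intros x Hx'. apply HX in Hx'. destruct Hx' as [n ->]. apply HwP.
  - intros x y z Hx' Hy' _ Hxz Hyz. apply HX in Hx', Hy'.
    destruct Hx' as [i ->], Hy' as [j ->].
    destruct (num_lt_total i j) as [L|[->|L]]; [|reflexivity|]; exfalso.
    + exact (Hinj i j z L Hxz Hyz).
    + exact (Hinj j i z L Hyz Hxz).
  (* Terms with distinct indices are incompatible, so [w] is one-to-one and its values are
     unbounded. *)
  - intros [k Hk].
    destruct (injective_unbounded w 0 k) as (j & _ & Hj); [assumption| |].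
    + intros i j E.
      destruct (num_lt_total i j) as [L|[->|L]]; [|reflexivity|]; exfalso.
      * apply (Hinj i j (w j) L); [rewrite E|]; apply Hrefl, HwP.
      * apply (Hinj j i (w i) L); [rewrite E|]; apply Hrefl, HwP.
    + assert (K : w j < k) by (apply Hk, HX; now exists j). ord.
Qed.

Lemma ACA0_ideals : ACA0 M -> no_infinite_strong_antichain_ideals M.
Proof.
  intros SC%ACA0_sigma1_comprehension P R HPR Hno.
  pose proof HPR as (Hsub & Hrefl & _ & Htrans).
  pose proof (delta1_compatible R SC) as DC.
  pose proof (delta1_splits R SC) as DS.
  pose (good x := x isin P /\ ~ splits R x).
  assert (DG : delta1 (fun e => good (e O))) by (unfold good; definable).
  assert (Hgood : forall x, x isin P -> exists y, pair x y isin R /\ good y).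
  { intros x Hx. apply NNPP; intros C. apply Hno.
    apply (splitting_infinite_strong_antichain P R x SC HPR Hx).
    intros y Hy. apply NNPP; intros D. apply C. exists y.
    split; [assumption|]. split; [|assumption].
    now apply (relation_field P R) in Hy. }
  assert (Hcone : forall x u v, good x -> pair x u isin R -> pair x v isin R ->
                    compatible R u v).
  { intros x u v [_ Hx] Hu Hv. apply NNPP; intros C. apply Hx.
    now exists u, v. }
  (* Transitivity passes through a good middle element, above which any two elements are
     compatible. *)
  assert (Ctrans : forall x y z, good y -> compatible R x y ->
                     compatible R y z -> compatible R x z).
  { intros x y z Hy (u & Hxu & Hyu) (v & Hyv & Hzv).
    destruct (Hcone y u v Hy Hyu Hyv) as (w & Huw & Hvw). exists w.
    split; [apply (Htrans _ u)|apply (Htrans _ v)]; assumption. }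
  (* [rep] selects the least member of each compatibility class of good elements. *)
  pose (rep i := good i /\ forall j, j < i -> good j -> ~ compatible R j i).
  assert (DR : delta1 (fun e => rep (e O))) by (unfold rep; definable).
  destruct (delta1_comprehension rep DR) as [X HX].
  assert (Hfin : finite X).
  { apply NNPP; intros C. apply Hno. exists X. split; [|exact C]. split.
    - intros x Hx. apply HX in Hx. apply Hx.
    - intros x y z Hx Hy _ Hxz Hyz. apply HX in Hx, Hy.
      destruct Hx as [Gx Hx], Hy as [Gy Hy].
      destruct (num_lt_total x y) as [L|[E|L]]; [|assumption|]; exfalso.
      + apply (Hy x L Gx). now exists z.
      + apply (Hx y L Gy). now exists z. }
  destruct Hfin as [k Hk].
  (* Sections at numbers that are not representatives are empty, and the empty set is an ideal. *)
  destruct (delta1_relation_comprehension (fun x i => rep i /\ compatible R x i))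
    as (A & HA & _); [definable|].
  exists k, A. split.
  - intros i Hi. unfold section. repeat split.
    + intros x Hx. apply HA in Hx. destruct Hx as (_ & z & Hz & _).
      now apply (relation_field P R) in Hz.
    + intros x y Hxy Hy. apply HA in Hy. apply HA.
      destruct Hy as (Hr & z & Hyz & Hiz). split; [assumption|].
      exists z. split; [apply (Htrans _ y)|]; assumption.
    + intros x y Hx Hy. apply HA in Hx, Hy.
      destruct Hx as (Hr & u & Hxu & Hiu), Hy as (_ & v & Hyv & Hiv).
      destruct (Hcone i u v (proj1 Hr) Hiu Hiv) as (w & Huw & Hvw).
      (* [w] lies above [i], so it belongs to the section and bounds [x] and [y] inside the
         ideal. *)
      exists w. repeat split.
      * apply HA. split; [assumption|]. exists w. split.
        -- apply Hrefl. now apply (relation_field P R) in Huw.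
        -- now apply (Htrans _ u).
      * now apply (Htrans _ u).
      * now apply (Htrans _ v).
  - intros x. split.
    + intros Hx. destruct (Hgood x Hx) as (y & Hxy & Hy).
      assert (Cyy : compatible R y y).
      { exists y. split; apply Hrefl, Hy. }
      (* The least good element compatible with [y] represents the class of [y]. *)
      destruct (sigma1_least (fun r => good r /\ compatible R r y) y)
        as (r & [Gr Cr] & Hr); [definable|now split|].
      assert (Rr : rep r).
      { split; [assumption|]. intros j Hj Gj Cj. apply (Hr j Hj).
        split; [assumption|]. now apply (Ctrans j r y). }
      exists r. split; [now apply Hk, HX|]. apply HA. split; [assumption|].
      destruct Cr as (z & Hrz & Hyz). exists z.
      split; [apply (Htrans _ y)|]; assumption.
    + intros (i & _ & Hi). apply HA in Hi. destruct Hi as (_ & z & Hz & _).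
      now apply (relation_field P R) in Hz.
Qed.

(** Two members of a strong antichain in the same ideal are equal, so the pigeonhole principle
    bounds its size by the number of ideals. *)
Lemma ideals_strong_antichains_bounded :
  no_infinite_strong_antichain_ideals M -> strong_antichains_bounded M.
Proof.
  intros H P R HPR Hno. destruct (H P R HPR Hno) as (k & A & HA & HP).
  exists k. intros X _ [HXP HX] n (F & (HFsub & HF) & HFinj & _).
  apply num_nlt_le; intros L.
  destruct (delta1_choice (fun i x => i < n -> pair i x isin F))
    as (f & Df & Hf).
  { definable. }
  { intros i. destruct (classic (i < n)) as [Hi|Hi].
    - destruct (HF i Hi) as (x & Hx & _). now exists x.
    - exists 0. tauto. }
  destruct (pigeonhole (fun i y => pair (f i) y isin A /\ y < k) k)
    as (i & j & y & Hij & Hj & [Hiy Hy] & [Hjy _]).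
  - definable.
  - intros i Hi. assert (Hin : i < n) by ord.
    destruct (HFsub _ (Hf i Hin)) as (i' & x & _ & Hx & E).
    apply pair_inj in E. destruct E as [_ <-].
    apply HXP, HP in Hx. destruct Hx as (y & Hy & Hiy).
    now exists y.
  - assert (Hin : i < n) by ord. assert (Hjn : j < n) by ord.
    destruct (HA y Hy) as [[Hsub _] Hc].
    destruct (Hc _ _ Hiy Hjy) as (z & Hz & Hiz & Hjz).
    assert (E : f i = f j).
    { apply (HX _ _ z); try assumption.
      - destruct (HFsub _ (Hf i Hin)) as (i' & x & _ & Hx & E).
        apply pair_inj in E. now destruct E as [_ ->].
      - destruct (HFsub _ (Hf j Hjn)) as (i' & x & _ & Hx & E).
        apply pair_inj in E. now destruct E as [_ ->].
      - now apply Hsub. }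
    assert (i = j) as ->; [|ord].
    apply (HFinj i j (f i)); [now apply Hf|rewrite E; now apply Hf].
Qed.

(** The first [k + 1] terms of an increasing sequence in an infinite strong antichain form a finite
    strong antichain of size [k + 1]. *)
Lemma bounded_no_infinite_strong_antichain (P R : sets M) :
  no_arbitrarily_large_finite_strong_antichains P R ->
  no_infinite_strong_antichain P R.
Proof.
  intros [k Hk] (X & [HXP HX] & Hinf).
  destruct (infinite_enumeration X Hinf) as (h & Dh & HhX & Hinc).
  destruct (delta1_comprehension (fun x => exists i, i < k + 1 /\ x = h i))
    as [Y HY]; [definable|].
  destruct (delta1_relation_comprehension (fun i x => i < k + 1 /\ x = h i))
    as (F & HF & HFsub); [definable|].
  assert (L : le (k + 1) k); [|apply (num_lt_irrefl k); now apply num_succ_le_iff].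
  apply (Hk Y).
  - exists (h (k + 1)). intros x Hx. apply HY in Hx.
    destruct Hx as (i & Hi & ->). now apply Hinc.
  - split.
    + intros x Hx. apply HY in Hx. destruct Hx as (i & _ & ->). apply HXP, HhX.
    + intros x y z Hx Hy. apply HY in Hx, Hy.
      destruct Hx as (i & _ & ->), Hy as (j & _ & ->). now apply HX.
  - exists F. repeat split.
    + intros p Hp. destruct (HFsub p Hp) as (i & x & ->). apply HF in Hp.
      exists i, x. repeat split; [apply Hp|]. apply HY. now exists i.
    + intros i Hi. exists (h i). split; [now apply HF|].
      intros x Hx. apply HF in Hx. now symmetry.
    + intros i j x Hi Hj. apply HF in Hi, Hj.
      destruct Hi as [Hi ->], Hj as [Hj E].
      destruct (num_lt_total i j) as [L|[->|L]]; [|reflexivity|];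
        apply Hinc in L; rewrite E in L; ord.
    + intros x Hx. apply HY in Hx. destruct Hx as (i & Hi & ->).
      exists i. now apply HF.
Qed.

Lemma ideals_bounded_strong_antichains_ideals :
  no_infinite_strong_antichain_ideals M -> bounded_strong_antichains_ideals M.
Proof.
  intros H P R HPR Hb. apply H; [assumption|].
  now apply bounded_no_infinite_strong_antichain.
Qed.

(** Statement (4) is applied to [I] with the restricted order. A strong antichain there is an
    antichain of [P], since the larger of two comparable elements bounds both; the ideals remain
    ideals of [P] because [I] is closed downwards. *)
Lemma ideals_initial_intervals_ideals :
  no_infinite_strong_antichain_ideals M -> initial_intervals_ideals M.
Proof.
  intros H P R (Hsub & Hrefl & Hanti & Htrans) Hno I [HIP HI].
  destruct (delta1_relation_comprehension
    (fun x y => pair x y isin R /\ x isin I /\ y isin I))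
    as (R' & HR' & HRsub); [definable|].
  destruct (H I R') as (k & A & HA & HU).
  - repeat split.
    + intros p Hp. destruct (HRsub p Hp) as (x & y & ->). apply HR' in Hp.
      exists x, y. tauto.
    + intros x Hx. apply HR'. auto.
    + intros x y Hx Hy. apply HR' in Hx, Hy. apply Hanti; tauto.
    + intros x y z Hx Hy. apply HR' in Hx, Hy. apply HR'.
      split; [apply (Htrans _ y)|]; tauto.
  - intros (X & [HXI HX] & Hinf). apply Hno. exists X. split; [|assumption].
    split; [auto|].
    assert (K : forall x y, x isin X -> y isin X -> pair x y isin R -> x = y).
    { intros x y Hx Hy Hxy. apply (HX x y y); auto; apply HR'; auto. }
    intros x y Hx Hy Hxy. split; intros C; apply Hxy; [auto|symmetry; auto].
  - exists k, A. split; [|assumption].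
    intros i Hi. destruct (HA i Hi) as [[H1 H2] H3]. repeat split.
    + auto.
    + intros x y Hxy Hy. apply (H2 x y); [|assumption].
      apply HR'. pose proof (H1 y Hy). split; [assumption|].
      split; [apply (HI x y)|]; assumption.
    + intros x y Hx Hy. destruct (H3 x y Hx Hy) as (z & Hz & Hxz & Hyz).
      exists z. apply HR' in Hxz, Hyz. tauto.
Qed.

(** An increasing sequence inside an infinite antichain is a bad sequence, and [P] is an initial
    interval of itself. *)
Lemma initial_intervals_wpo_ideals :
  initial_intervals_ideals M -> wpo_ideals M.
Proof.
  intros H P R [HPR Hwpo].
  apply (H P R HPR); [|split; [auto|]].
  - intros (X & [HXP HX] & Hinf).
    destruct (infinite_enumeration X Hinf) as (h & Dh & HhX & Hinc).
    destruct (delta1_relation_comprehension (fun i x => x = h i))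
      as (F & HF & HFsub); [definable|].
    destruct (Hwpo F) as (i & j & x & y & Hij & Hi & Hj & Hxy).
    + split.
      * intros p Hp. destruct (HFsub p Hp) as (i & x & ->). apply HF in Hp.
        exists i, x. subst x. auto.
      * intros i _. exists (h i). split; [now apply HF|].
        intros x Hx. apply HF in Hx. now symmetry.
    + apply HF in Hi, Hj. subst x y. apply Hinc in Hij.
      destruct (HX (h i) (h j)) as [C _]; auto.
      intros E. rewrite E in Hij. ord.
  - intros x y Hxy _. exact (proj1 (relation_field P R x y (proj1 HPR) Hxy)).
Qed.

End Ideals.

(** * Reversals *)

Section Ranges.

Context {M : L2structure} {hM : RCA0 M}.
Local Notation N := (num M).

Add Ring num_ring_ranges : (@num_semi_ring M hM).

Definition has_range (f : N -> N) : Prop :=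
  exists X : sets M, forall y, y isin X <-> exists n, f n = y.

Lemma sigma1_witness (p : N -> Prop) : sigma1 (fun e => p (e O)) ->
  exists r : N -> N -> Prop, delta1 (fun e => r (e O) (e 1%nat)) /\
    forall y, p y <-> exists s, r s y.
Proof.
  intros (q & Hq & E).
  exists (fun s y => q (scons s (scons y (fun _ => 0)))). split.
  - apply bdd_delta1.
    apply (bdd_ext (fun e => q (fun i => match i with
      | O => e O | 1%nat => e 1%nat | _ => 0 end))).
    + apply (bdd_subst q (fun i e => match i with
        | O => e O | 1%nat => e 1%nat | _ => 0 end) Hq).
      intros [|[|i]]; poly.
    + intros e.
      replace (scons (e O) (scons (e 1%nat) (fun _ => 0))) with (fun i =>
        match i with O => e O | 1%nat => e 1%nat | _ => 0 end);
        [reflexivity|].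
      apply functional_extensionality; intros [|[|i]]; reflexivity.
  - intros y. exact (E (scons y (fun _ => 0))).
Qed.

Lemma double_lt (a b : N) : a < b -> a + a + 1 < b + b.
Proof.
  intros [k ->]%num_lt_iff. apply num_lt_iff. exists (k + k). ring.
Qed.

Lemma double_inj (a b : N) : a + a = b + b -> a = b.
Proof.
  intros E. destruct (num_lt_total a b) as [L|[L|L]]; [|assumption|];
    apply double_lt in L; rewrite E in L;
    [pose proof (num_lt_add1 (b + b))|pose proof (num_lt_add1 (b + b))]; ord.
Qed.

Lemma double_neq_double_succ (a b : N) : a + a <> b + b + 1.
Proof.
  intros E. destruct (num_lt_total a b) as [L|[->|L]].
  - apply double_lt in L. rewrite E in L.
    pose proof (num_lt_add1 (b + b)). pose proof (num_lt_add1 (b + b + 1)). ord.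
  - apply (num_lt_irrefl (b + b)). rewrite E at 2. apply num_lt_add1.
  - apply double_lt in L. rewrite E in L. ord.
Qed.

(** [f] sends the pair of the least witness for [y] and [y] to [2 y], and every other number to an
    odd one. Keeping only the least witness makes [f] one-to-one, and [p y] holds exactly if [2 y]
    is in the range. *)
Lemma ranges_sigma1_comprehension :
  (forall f : N -> N, delta1_fun (fun e => f (e O)) ->
     (forall i j, f i = f j -> i = j) -> has_range f) ->
  @sigma1_comprehension M.
Proof.
  intros H p Hp. destruct (sigma1_witness p Hp) as (r & Dr & Er).
  pose (r1 s y := r s y /\ forall s', s' < s -> ~ r s' y).
  assert (D1 : delta1 (fun e => r1 (e O) (e 1%nat))) by (unfold r1; definable).
  assert (U1 : forall s s' y, r1 s y -> r1 s' y -> s = s').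
  { intros s s' y [H1 H2] [H3 H4].
    destruct (num_lt_total s s') as [L|[L|L]]; [|assumption|]; exfalso.
    - exact (H4 s L H1).
    - exact (H2 s' L H3). }
  pose (hit t := t = pair (pfst t) (psnd t) /\ r1 (pfst t) (psnd t)).
  assert (Dh : delta1 (fun e => hit (e O))) by (unfold hit; definable).
  destruct (delta1_choice (fun t v =>
    hit t /\ v = psnd t + psnd t \/ ~ hit t /\ v = t + t + 1))
    as (f & Df & Hf).
  { definable. }
  { intros t. destruct (classic (hit t)); eexists; [left|right]; eauto. }
  destruct (H f Df) as [X HX].
  { intros i j E.
    destruct (Hf i) as [[Hi Ei]|[Hi Ei]], (Hf j) as [[Hj Ej]|[Hj Ej]];
      rewrite Ei, Ej in E.
    - apply double_inj in E. destruct Hi as [Fi Hi], Hj as [Fj Hj].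
      rewrite E in Fi, Hi. rewrite (U1 _ _ _ Hi Hj) in Fi. congruence.
    - now apply double_neq_double_succ in E.
    - symmetry in E. now apply double_neq_double_succ in E.
    - apply double_inj. now apply num_add_cancel in E. }
  destruct (delta1_comprehension (fun y => y + y isin X)) as [Y HY];
    [definable|].
  exists Y. intros y. rewrite HY, HX, Er. split.
  - intros [t Ht]. destruct (Hf t) as [[[_ Hr] E]|[_ E]]; rewrite E in Ht.
    + apply double_inj in Ht. rewrite Ht in Hr. exists (pfst t). apply Hr.
    + symmetry in Ht. now apply double_neq_double_succ in Ht.
  - intros [s Hs].
    destruct (sigma1_least (fun s => r s y) s) as (s' & Hs' & Hmin);
      [definable|assumption|].
    exists (pair s' y). destruct (Hf (pair s' y)) as [[_ E]|[C _]].
    + now rewrite psnd_pair in E.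
    + exfalso. apply C. unfold hit. rewrite pfst_pair, psnd_pair.
      split; [reflexivity|]. now split.
Qed.

End Ranges.

(** * True and false stages of a one-to-one function *)

Section Stages.

Context {M : L2structure} {hM : RCA0 M}.
Local Notation N := (num M).

Variable f : N -> N.
Hypothesis Df : delta1_fun (fun e => f (e O)).
Hypothesis f_inj : forall i j, f i = f j -> i = j.

(** Writing [k < s + 1] admits the witness [k = s], so a stage [k] refutes [n] already at
    [s = k]. *)
Definition false_at (n s : N) : Prop :=
  exists k, k < s + 1 /\ n < k /\ f k < f n.

Definition true_stage (n : N) : Prop := forall k, n < k -> f n < f k.

Lemma delta1_false_at : delta1 (fun e => false_at (e O) (e 1%nat)).
Proof. unfold false_at. definable. Qed.

Lemma false_at_mono n s t : le s t -> false_at n s -> false_at n t.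
Proof. intros H (k & Hk & K). exists k. split; [ord|assumption]. Qed.

Lemma false_at_lt n s : false_at n s -> n < s.
Proof. intros (k & Hk & Hn & _). ord. Qed.

Lemma not_false_at n s k :
  ~ false_at n s -> n < k -> le k s -> f n < f k.
Proof.
  intros H Hn Hk. apply NNPP; intros C. apply H. exists k.
  split; [now apply num_lt_succ_iff_le|]. split; [assumption|].
  apply num_nlt_le in C. destruct C as [C|C]; [assumption|].
  apply f_inj in C. ord.
Qed.

Lemma true_stage_not_false_at n s : true_stage n -> ~ false_at n s.
Proof. intros H (k & _ & Hn & Hk). specialize (H k Hn). ord. Qed.

Lemma true_stage_or_false_at n : true_stage n \/ exists s, false_at n s.
Proof.
  destruct (classic (exists s, false_at n s)) as [H|H]; [now right|left].
  intros k Hk. apply (not_false_at n k); [|assumption|apply num_le_refl].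
  intros C. apply H. now exists k.
Qed.

(** A place where [f] takes its least value on the numbers from [b] on is a true stage. *)
Lemma true_stage_unbounded b : exists n, le b n /\ true_stage n.
Proof.
  destruct (sigma1_least (fun v => exists n, le b n /\ f n = v) (f b))
    as (v & (n & Hn & Ev) & Hmin).
  - definable.
  - exists b. split; [apply num_le_refl|reflexivity].
  - exists n. split; [assumption|]. intros k Hk. apply NNPP; intros C.
    apply num_nlt_le in C. destruct C as [C|C]; [|apply f_inj in C; ord].
    subst v. apply (Hmin (f k) C). exists k. split; [ord|reflexivity].
Qed.

(** If [t] is true and [y < f t], then [y] can be a value of [f] only at an argument up to [t]. Such
    [t] are found in [q], so the complement of the range is Sigma-1. *)
Lemma true_stages_range (q : N -> Prop) : sigma1 (fun e => q (e O)) ->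
  (forall t, q t -> true_stage t) -> (forall b, exists t, q t /\ le b t) ->
  has_range f.
Proof.
  intros Dq Htrue Hunb.
  (* [f] increases along true stages, so its values on [q] are unbounded. *)
  assert (K : forall y, exists t, q t /\ y < f t).
  { refine (sigma1_induction (fun y => exists t, q t /\ y < f t) _ _ _).
    - definable.
    - destruct (Hunb 0) as (t & Ht & _).
      destruct (Hunb (t + 1)) as (t' & Ht' & L).
      exists t'. split; [assumption|].
      apply (num_le_lt_trans _ (f t)); [apply num_0_le|].
      apply (Htrue t Ht). ord.
    - intros y (t & Ht & Hy).
      destruct (Hunb (t + 1)) as (t' & Ht' & L).
      exists t'. split; [assumption|].
      apply (num_le_lt_trans _ (f t)); [now apply num_succ_le_iff|].
      apply (Htrue t Ht). ord. }
  apply delta1_comprehension. split; [definable|].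
  apply (sigma1_ext (fun e => exists t, q t /\ e O < f t /\
    forall n, n < t + 1 -> f n <> e O)); [definable|].
  intros e; split.
  - intros (t & Ht & Hy & H) [n Hn]. apply (H n); [|assumption].
    apply num_lt_succ_iff_le, num_nlt_le. intros L.
    apply (Htrue t Ht) in L. rewrite Hn in L. ord.
  - intros H. destruct (K (e O)) as (t & Ht & Hy). exists t.
    repeat split; [assumption|assumption|].
    intros n _ E. apply H. now exists n.
Qed.

(** A linear order in which the false stages come first, in order type omega,
    followed by the true stages in reverse order. *)
Definition stage_le (n m : N) : Prop :=
  n = m \/ n < m /\ false_at n m \/ m < n /\ ~ false_at m n.

Lemma delta1_stage_le : delta1 (fun e => stage_le (e O) (e 1%nat)).
Proof. pose proof delta1_false_at. unfold stage_le. definable. Qed.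

Lemma stage_le_total n m : stage_le n m \/ stage_le m n.
Proof.
  unfold stage_le. destruct (num_lt_total n m) as [L|[L|L]]; [|auto|].
  - destruct (classic (false_at n m)); auto.
  - destruct (classic (false_at m n)); auto.
Qed.

Lemma stage_le_antisym n m : stage_le n m -> stage_le m n -> n = m.
Proof.
  intros [H|[[H K]|[H K]]] [H'|[[H' K']|[H' K']]]; auto; solve [ord | tauto].
Qed.

(** Serves the transitivity of [stage_le] and that of the ladder, where a rung [pair 1 s] lies above
    exactly the stages seen to be false by [s]. *)
Lemma stage_le_false_at n m s :
  stage_le n m -> false_at m s -> false_at n s.
Proof.
  intros [->|[[L H]|[L H]]] K; [assumption| |].
  - apply (false_at_mono n m); [|assumption]. left. now apply false_at_lt.
  (* A witness [k] for [m] must come after [n], and [f k < f m < f n] makes it a witness for [n]. *)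
  - destruct K as (k & Hk & Hmk & Hf). exists k.
    assert (Hn : n < k).
    { apply num_nle_lt. intros C.
      pose proof (not_false_at m n k H Hmk C). ord. }
    pose proof (not_false_at m n n H L (num_le_refl n)).
    repeat split; [assumption|assumption|ord].
Qed.

Lemma stage_le_trans a b c : stage_le a b -> stage_le b c -> stage_le a c.
Proof.
  intros Hab Hbc.
  destruct (classic (a = c)) as [->|Hac]; [now left|].
  destruct Hbc as [<-|[[L H]|[L H]]]; [assumption| |].
  - pose proof (stage_le_false_at a b c Hab H) as K.
    right; left. split; [now apply false_at_lt|assumption].
  - destruct Hab as [->|[[L' H']|[L' H']]].
    + right; right. now split.
    + apply num_lt_neq in Hac. destruct Hac as [Hac|Hac].
      * right; left. split; [assumption|].
        destruct H' as (k & Hk & Hak & Hf).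
        (* If [k] comes after [c], then [f c < f k < f a], so [c] itself is a witness for [a]. *)
        destruct (classic (k < c + 1)) as [Hkc|Hkc]; [now exists k|].
        exists c. split; [apply num_lt_add1|]. split; [assumption|].
        pose proof (num_lt_add1 c).
        assert (f c < f k) by (apply (not_false_at c b k H); ord). ord.
      * right; right. split; [assumption|]. intros C. apply H.
        apply (false_at_mono c a); [now left|assumption].
    (* A witness [k] for [c] would contradict [not_false_at] for [b] if [k > b], and for [c] if
       [k <= b]. *)
    + right; right. split; [ord|]. intros (k & Hk & Hck & Hf).
      pose proof (not_false_at c b b H L (num_le_refl b)).
      destruct (classic (b < k)) as [Hbk|Hbk].
      * assert (f b < f k) by (apply (not_false_at b a k H'); ord). ord.
      * apply num_nlt_le in Hbk.
        pose proof (not_false_at c b k H Hck Hbk). ord.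
Qed.

(** The sum of [stage_le] and of a chain [pair 1 s] of order type omega, the
    stage [pair 0 n] being put below [pair 1 s] when it is seen to be false. *)
Definition ladder_le (x y : N) : Prop :=
  pfst x = 0 /\ pfst y = 0 /\ stage_le (psnd x) (psnd y) \/
  pfst x = 0 /\ pfst y = 1 /\ false_at (psnd x) (psnd y) \/
  pfst x = 1 /\ pfst y = 1 /\ le (psnd x) (psnd y).

Definition ladder_node (x : N) : Prop :=
  x = pair (pfst x) (psnd x) /\ (pfst x = 0 \/ pfst x = 1).

Definition ladder (P R : sets M) : Prop :=
  (forall x, x isin P <-> ladder_node x) /\
  (forall x y, pair x y isin R <->
     ladder_node x /\ ladder_node y /\ ladder_le x y) /\
  (forall p, p isin R -> exists x y, p = pair x y).

Lemma ladder_exists : exists P R, ladder P R.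
Proof.
  pose proof delta1_false_at. pose proof delta1_stage_le.
  destruct (delta1_comprehension ladder_node) as [P HP].
  { unfold ladder_node. definable. }
  destruct (delta1_relation_comprehension
    (fun x y => ladder_node x /\ ladder_node y /\ ladder_le x y)) as [R HR].
  { unfold ladder_le, ladder_node. definable. }
  exists P, R. now split.
Qed.

Lemma num_0_neq_1 : (0 : N) <> 1.
Proof. intros E. apply (num_succ_neq0 0). now rewrite num_add_0_l. Qed.

Lemma ladder_node_cases x :
  ladder_node x <-> (exists n, x = pair 0 n) \/ exists s, x = pair 1 s.
Proof.
  split.
  - intros [E [F|F]]; rewrite F in E; [left|right]; now exists (psnd x).
  - unfold ladder_node.
    intros [[n ->]|[n ->]]; rewrite pfst_pair, psnd_pair; auto.
Qed.

(** * The ladder: its ideals, strong antichains and bad sequences *)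

Section Ladder.

Variables P R : sets M.
Hypothesis L : ladder P R.

Lemma ladder_stage n : pair 0 n isin P.
Proof. apply L, ladder_node_cases. left; now exists n. Qed.

Lemma ladder_rung s : pair 1 s isin P.
Proof. apply L, ladder_node_cases. right; now exists s. Qed.

Lemma ladder_cases x :
  x isin P -> (exists n, x = pair 0 n) \/ exists s, x = pair 1 s.
Proof. intros H. now apply ladder_node_cases, L. Qed.

Lemma ladder_stage_stage n m :
  pair (pair 0 n) (pair 0 m) isin R <-> stage_le n m.
Proof.
  destruct L as (HP & HR & _).
  rewrite HR, <- !HP. unfold ladder_le. rewrite !pfst_pair, !psnd_pair.
  pose proof num_0_neq_1. pose proof (ladder_stage n).
  pose proof (ladder_stage m). intuition congruence.
Qed.

Lemma ladder_stage_rung n s :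
  pair (pair 0 n) (pair 1 s) isin R <-> false_at n s.
Proof.
  destruct L as (HP & HR & _).
  rewrite HR, <- !HP. unfold ladder_le. rewrite !pfst_pair, !psnd_pair.
  pose proof num_0_neq_1. pose proof (ladder_stage n).
  pose proof (ladder_rung s). intuition congruence.
Qed.

Lemma ladder_rung_rung s t :
  pair (pair 1 s) (pair 1 t) isin R <-> le s t.
Proof.
  destruct L as (HP & HR & _).
  rewrite HR, <- !HP. unfold ladder_le. rewrite !pfst_pair, !psnd_pair.
  pose proof num_0_neq_1. pose proof (ladder_rung s).
  pose proof (ladder_rung t). intuition congruence.
Qed.

Lemma ladder_rung_stage s n : ~ pair (pair 1 s) (pair 0 n) isin R.
Proof.
  destruct L as (HP & HR & _).
  rewrite HR, <- !HP. unfold ladder_le. rewrite !pfst_pair, !psnd_pair.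
  pose proof num_0_neq_1. intuition congruence.
Qed.

Lemma ladder_field x y : pair x y isin R -> x isin P /\ y isin P.
Proof. destruct L as (HP & HR & _). rewrite HR, !HP. tauto. Qed.

Lemma ladder_partial_order : partial_order P R.
Proof.
  repeat split.
  - intros p Hp. destruct L as (_ & _ & K).
    destruct (K p Hp) as (x & y & ->). exists x, y.
    apply ladder_field in Hp. tauto.
  - intros x Hx.
    apply ladder_cases in Hx. destruct Hx as [[n ->]|[s ->]].
    + apply ladder_stage_stage. now left.
    + apply ladder_rung_rung, num_le_refl.
  - intros x y Hxy Hyx. pose proof (ladder_field _ _ Hxy) as [Hx Hy].
    apply ladder_cases in Hx, Hy.
    destruct Hx as [[n ->]|[s ->]], Hy as [[m ->]|[t ->]].
    + f_equal. apply ladder_stage_stage in Hxy, Hyx.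
      now apply stage_le_antisym.
    + now apply ladder_rung_stage in Hyx.
    + now apply ladder_rung_stage in Hxy.
    + f_equal. apply ladder_rung_rung in Hxy, Hyx. ord.
  - intros x y z Hxy Hyz. pose proof (ladder_field _ _ Hxy) as [Hx Hy].
    pose proof (ladder_field _ _ Hyz) as [_ Hz].
    apply ladder_cases in Hx, Hy, Hz.
    destruct Hx as [[n ->]|[s ->]], Hy as [[m ->]|[t ->]],
      Hz as [[l ->]|[u ->]];
      try (now apply ladder_rung_stage in Hxy);
      try (now apply ladder_rung_stage in Hyz).
    + apply ladder_stage_stage in Hxy, Hyz. apply ladder_stage_stage.
      now apply (stage_le_trans n m).
    + apply ladder_stage_stage in Hxy. apply ladder_stage_rung in Hyz.
      apply ladder_stage_rung. now apply (stage_le_false_at n m).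
    + apply ladder_stage_rung in Hxy. apply ladder_rung_rung in Hyz.
      apply ladder_stage_rung. now apply (false_at_mono n t).
    + apply ladder_rung_rung in Hxy, Hyz. apply ladder_rung_rung. ord.
Qed.

(** An ideal with all rungs contains exactly the false stages: each of these lies below a rung,
    while a true stage and a rung have no common upper bound. *)
Lemma ladder_ideals_range : finite_union_of_ideals P R P -> has_range f.
Proof.
  intros (k & A & HA & HU).
  (* If each of the [k] ideals missed a rung, collection would give one [b] above the missed
     indices, and the rung [pair 1 b] would lie in no ideal. *)
  assert (K : exists i, i < k /\ forall s, section A i (pair 1 s)).
  { apply NNPP; intros C.
    destruct (sigma1_bounding (fun s i => ~ pair (pair 1 s) i isin A) k)
      as [b Hb].
    - definable.
    - intros i Hi. apply NNPP; intros D. apply C. exists i.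
      split; [assumption|]. intros s. apply NNPP; intros E.
      apply D. now exists s.
    - pose proof (ladder_rung b) as Hc. apply HU in Hc.
      destruct Hc as (i & Hi & Hbi). destruct (Hb i Hi) as (s & Hs & C').
      apply C'. destruct (HA i Hi) as [[_ H] _].
      apply (H _ (pair 1 b)); [|assumption].
      apply ladder_rung_rung. now left. }
  destruct K as (i & Hi & Hrungs). destruct (HA i Hi) as [[HAP HAdown] HAc].
  assert (Htrue : forall n, ~ section A i (pair 0 n) <-> true_stage n).
  { intros n. split.
    - intros C. destruct (true_stage_or_false_at n) as [T|[s Hs]];
        [assumption|].
      exfalso. apply C, (HAdown _ (pair 1 s)); [|apply Hrungs].
      now apply ladder_stage_rung.
    - intros T C. destruct (HAc _ _ C (Hrungs 0)) as (z & Hz & Hnz & Hsz).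
      apply HAP, ladder_cases in Hz. destruct Hz as [[m ->]|[s ->]].
      + now apply ladder_rung_stage in Hsz.
      + apply ladder_stage_rung in Hnz.
        exact (true_stage_not_false_at n s T Hnz). }
  apply (true_stages_range (fun n => ~ pair (pair 0 n) i isin A)).
  - definable.
  - intros n. apply Htrue.
  - intros b. destruct (true_stage_unbounded b) as (n & Hn & T).
    exists n. split; [now apply Htrue|assumption].
Qed.

(** Stages are linearly ordered, and so are rungs; among three members of a strong antichain two are
    of the same kind and hence equal. *)
Lemma ladder_strong_antichains_bounded :
  no_arbitrarily_large_finite_strong_antichains P R.
Proof.
  exists (1 + 1). intros X _ [HXP HX] n (F & (HFsub & HF) & HFinj & _).
  apply num_nlt_le; intros Ln.
  assert (K : forall i, i < n -> exists x, pair i x isin F /\ x isin X).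
  { intros i Hi. destruct (HF i Hi) as (x & Hx & _). exists x.
    split; [assumption|].
    destruct (HFsub _ Hx) as (i' & x' & _ & Hx' & E).
    apply pair_inj in E. now destruct E as [_ ->]. }
  assert (L0 : (0 : N) < 1) by (rewrite <- (num_add_0_l 1); apply num_lt_add1).
  pose proof (num_lt_add1 (1 : N)) as L1.
  assert (Hstage : forall a b, pair 0 a isin X -> pair 0 b isin X ->
                     pair 0 a = pair 0 b).
  { intros a b Ha Hb. destruct (stage_le_total a b) as [H|H].
    - apply (HX _ _ (pair 0 b)); auto using ladder_stage;
        apply ladder_stage_stage; [assumption|now left].
    - apply (HX _ _ (pair 0 a)); auto using ladder_stage;
        apply ladder_stage_stage; [now left|assumption]. }
  assert (Hrung : forall a b, pair 1 a isin X -> pair 1 b isin X ->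
                    pair 1 a = pair 1 b).
  { intros a b Ha Hb. destruct (classic (a < b)) as [H|H].
    - apply (HX _ _ (pair 1 b)); auto using ladder_rung;
        apply ladder_rung_rung; [now left|now right].
    - apply num_nlt_le in H.
      apply (HX _ _ (pair 1 a)); auto using ladder_rung;
        apply ladder_rung_rung; [now right|assumption]. }
  destruct (K 0) as (x0 & Fx0 & Hx0); [ord|].
  destruct (K 1) as (x1 & Fx1 & Hx1); [ord|].
  destruct (K (1 + 1)) as (x2 & Fx2 & Hx2); [ord|].
  assert (N01 : x0 <> x1).
  { intros ->. pose proof (HFinj _ _ _ Fx0 Fx1). now apply num_0_neq_1. }
  assert (N02 : x0 <> x2).
  { intros ->. pose proof (HFinj _ _ _ Fx0 Fx2) as E. rewrite <- E in L1. ord. }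
  assert (N12 : x1 <> x2).
  { intros ->. pose proof (HFinj _ _ _ Fx1 Fx2) as E. rewrite <- E in L1. ord. }
  pose proof (ladder_cases _ (HXP _ Hx0)) as [[a ->]|[a ->]];
  pose proof (ladder_cases _ (HXP _ Hx1)) as [[b ->]|[b ->]];
  pose proof (ladder_cases _ (HXP _ Hx2)) as [[c ->]|[c ->]]; auto.
Qed.

(** The stages in a bad sequence are true and unbounded. *)
Lemma ladder_not_wpo_range : ~ well_partial_order P R -> has_range f.
Proof.
  intros H.
  assert (K : exists F, is_function F (fun _ => True) (mem P) /\
    forall i j x y, i < j -> pair i x isin F -> pair j y isin F ->
      ~ pair x y isin R).
  { apply NNPP; intros C. apply H. split; [apply ladder_partial_order|].
    intros F HF. apply NNPP; intros D. apply C. exists F.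
    split; [assumption|]. intros i j x y Hij Hx Hy Hxy.
    apply D. now exists i, j, x, y. }
  destruct K as (F & [HFsub HF] & HFbad).
  destruct (delta1_choice (fun i x => pair i x isin F)) as (h & Dh & Hh).
  { definable. }
  { intros i. destruct (HF i I) as (x & Hx & _). now exists x. }
  assert (HhP : forall i, h i isin P).
  { intros i. destruct (HFsub _ (Hh i)) as (i' & x & _ & Hx & E).
    apply pair_inj in E. now destruct E as [_ ->]. }
  assert (Hbad : forall i j, i < j -> ~ pair (h i) (h j) isin R).
  { intros i j Hij. exact (HFbad i j _ _ Hij (Hh i) (Hh j)). }
  assert (Hinj : forall i j, h i = h j -> i = j).
  { intros i j E. destruct ladder_partial_order as (_ & Hrefl & _).
    destruct (num_lt_total i j) as [Lij|[Lij|Lij]]; [|assumption|];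
      apply Hbad in Lij; exfalso; apply Lij; rewrite E; apply Hrefl, HhP. }
  assert (Hunb : forall a b, exists j, a < j /\
    (forall n, h j = pair 0 n -> b < n) /\ forall s, h j = pair 1 s -> b < s).
  { intros a b.
    (* As [h] is one-to-one, some later value exceeds both [pair 0 b] and [pair 1 b]. *)
    destruct (injective_unbounded h (a + 1) (pair 1 b + pair 0 b + 1) Dh Hinj)
      as (j & Hj & Hb).
    exists j. split; [ord|].
    split; intros n E; apply num_nle_lt; intros C; rewrite E in Hb.
    - pose proof (pair_le 0 n 0 b (num_le_refl 0) C).
      assert (le (pair 0 b) (pair 1 b + pair 0 b)).
      { apply num_le_iff. exists (pair 1 b). apply num_add_comm. }
      ord.
    - pose proof (pair_le 1 n 1 b (num_le_refl 1) C).
      assert (le (pair 1 b) (pair 1 b + pair 0 b)).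
      { apply num_le_iff. now exists (pair 0 b). }
      ord. }
  apply (true_stages_range (fun n => exists i, h i = pair 0 n)).
  - definable.
  (* If stage [n] were seen to be false at [s], a later term of index beyond [s] would lie above
     it. *)
  - intros n [i Hi]. destruct (true_stage_or_false_at n) as [T|[s Hs]];
      [assumption|exfalso].
    destruct (Hunb i s) as (j & Hij & H0 & H1).
    apply (Hbad i j Hij). rewrite Hi.
    destruct (ladder_cases _ (HhP j)) as [[m E]|[t E]]; rewrite E.
    + apply ladder_stage_stage. right; left.
      pose proof (false_at_mono n s m (or_introl (H0 m E)) Hs) as K.
      split; [now apply false_at_lt|assumption].
    + apply ladder_stage_rung.
      exact (false_at_mono n s t (or_introl (H1 t E)) Hs).
  (* Rungs in a bad sequence have decreasing indices, so once a rung has occurred, a later term of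
     large index must be a stage. *)
  - intros b.
    destruct (ladder_cases _ (HhP 0)) as [[m E]|[t E]].
    + destruct (Hunb 0 b) as (j & Hj & H0 & H1).
      destruct (ladder_cases _ (HhP j)) as [[n En]|[s Es]].
      * exists n. split; [now exists j|left; auto].
      * destruct (Hunb j (b + s)) as (j' & Hj' & H0' & H1').
        destruct (ladder_cases _ (HhP j')) as [[n En]|[s' Es']].
        -- exists n. split; [now exists j'|]. specialize (H0' n En).
           assert (le b (b + s)) by (apply num_le_iff; now exists s). ord.
        -- exfalso. apply (Hbad j j' Hj'). rewrite Es, Es'.
           apply ladder_rung_rung. specialize (H1' s' Es').
           assert (le s (b + s)).
           { apply num_le_iff. exists b. apply num_add_comm. }
           ord.
    + destruct (Hunb 0 (b + t)) as (j' & Hj' & H0' & H1').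
      destruct (ladder_cases _ (HhP j')) as [[n En]|[s' Es']].
      * exists n. split; [now exists j'|]. specialize (H0' n En).
        assert (le b (b + t)) by (apply num_le_iff; now exists t). ord.
      * exfalso. apply (Hbad 0 j' Hj'). rewrite E, Es'.
        apply ladder_rung_rung. specialize (H1' s' Es').
        assert (le t (b + t)).
        { apply num_le_iff. exists b. apply num_add_comm. }
        ord.
Qed.

End Ladder.

(** Stage [n] is replaced by the [n + 1] incomparable elements [pair n i],
    [i <= n]; if [n] is true they are maximal. *)
Lemma strong_antichains_bounded_range :
  strong_antichains_bounded M -> has_range f.
Proof.
  intros H. pose proof delta1_false_at as DF.
  pose (node x := x = pair (pfst x) (psnd x) /\ psnd x < pfst x + 1).
  assert (Dn : delta1 (fun e => node (e O))) by (unfold node; definable).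
  assert (Hnode : forall n i, node (pair n i) <-> i < n + 1).
  { intros n i. unfold node. rewrite pfst_pair, psnd_pair. tauto. }
  destruct (delta1_comprehension node Dn) as [P HP].
  destruct (delta1_relation_comprehension (fun x y => node x /\ node y /\
    (x = y \/ false_at (pfst x) (pfst y)))) as (R & HR & HRsub); [definable|].
  assert (HPR : partial_order P R).
  { repeat split.
    - intros p Hp. destruct (HRsub p Hp) as (x & y & ->). apply HR in Hp.
      exists x, y. rewrite !HP. tauto.
    - intros x Hx. apply HP in Hx. apply HR. auto.
    - intros x y Hxy Hyx. apply HR in Hxy, Hyx.
      destruct Hxy as (_ & _ & [E|Hxy]); [assumption|].
      destruct Hyx as (_ & _ & [E|Hyx]); [now symmetry|].
      apply false_at_lt in Hxy, Hyx. ord.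
    - intros x y z Hxy Hyz. apply HR in Hxy, Hyz. apply HR.
      destruct Hxy as (Hx & Hy & [->|Hxy]); [assumption|].
      destruct Hyz as (_ & Hz & [<-|Hyz]); [auto|].
      repeat split; try apply Hx; try apply Hz. right.
      apply (false_at_mono _ (pfst y)); [|assumption].
      left. now apply false_at_lt. }
  destruct (classic (no_infinite_strong_antichain P R)) as [Hno|Hyes].
  - exfalso. destruct (H P R HPR Hno) as [k Hk].
    destruct (true_stage_unbounded k) as (n & Hn & T).
    destruct (delta1_comprehension
      (fun x => exists i, i < n + 1 /\ x = pair n i)) as [X HX]; [definable|].
    destruct (delta1_relation_comprehension
      (fun i x => i < n + 1 /\ x = pair n i)) as (F & HF & HFsub); [definable|].
    (* The [n + 1] elements over a true stage [n >= k] form a strong antichain that is too large. *)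
    assert (C : le (n + 1) k); [|ord].
    apply (Hk X).
    + exists (pair n (n + 1)). intros x Hx. apply HX in Hx.
      destruct Hx as (i & Hi & ->). apply pair_lt.
      apply num_lt_iff in Hi. destruct Hi as [j Hj]. apply num_lt_iff.
      exists j. now rewrite Hj, !num_add_assoc.
    + split.
      * intros x Hx. apply HX in Hx. destruct Hx as (i & Hi & ->).
        now apply HP, Hnode.
      * assert (Hmax : forall i z, pair (pair n i) z isin R -> pair n i = z).
        { intros i z Hz. apply HR in Hz. destruct Hz as (_ & _ & [E|Hz]);
            [assumption|].
          rewrite pfst_pair in Hz.
          now destruct (true_stage_not_false_at n (pfst z) T). }
        intros x y z Hx Hy _ Hxz Hyz. apply HX in Hx, Hy.
        destruct Hx as (i & _ & ->), Hy as (j & _ & ->).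
        apply Hmax in Hxz, Hyz. congruence.
    + exists F. repeat split.
      * intros p Hp. destruct (HFsub p Hp) as (i & x & ->). apply HF in Hp.
        exists i, x. repeat split; [apply Hp|]. apply HX. now exists i.
      * intros i Hi. exists (pair n i). split; [now apply HF|].
        intros x Hx. apply HF in Hx. now symmetry.
      * intros i j x Hi Hj. apply HF in Hi, Hj.
        destruct Hi as [_ ->], Hj as [_ E]. now apply pair_inj in E.
      * intros x Hx. apply HX in Hx. destruct Hx as (i & Hi & ->).
        exists i. now apply HF.
  - apply NNPP in Hyes. destruct Hyes as (X & [HXP HX] & Hinf).
    (* The second component of a node is at most the first, so an element beyond [pair b b] has its
       stage beyond [b]. *)
    assert (Hunb : forall b, exists n i, b < n /\ pair n i isin X).
    { intros b. destruct (infinite_unbounded X (pair b b) Hinf) as (x & Hx & L).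
      pose proof (HXP x Hx) as K. apply HP in K. destruct K as [E Hi].
      exists (pfst x), (psnd x). rewrite <- E. split; [|assumption].
      apply num_nle_lt. intros C.
      assert (K : le x (pair b b)) by (rewrite E; apply pair_le; ord). ord. }
    apply (true_stages_range
      (fun n => exists i, i < n + 1 /\ pair n i isin X)).
    + definable.
    + intros n (i & Hi & Hni).
      destruct (true_stage_or_false_at n) as [T|[s Hs]]; [assumption|exfalso].
      destruct (Hunb s) as (m & j & Hm & Hmj).
      (* If [n] is false at [s], then [pair n i] lies below the element [pair m j] of [X], whose
         stage is beyond [s]. *)
      assert (K : pair n i = pair m j).
      { apply (HX _ _ (pair m j)); auto.
        - apply HR. repeat split; try (now apply HP, HXP). right.
          rewrite !pfst_pair. apply (false_at_mono n s); [now left|assumption].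
        - apply HR. repeat split; try (now apply HP, HXP). now left. }
      apply pair_inj in K. destruct K as [-> _]. apply false_at_lt in Hs. ord.
    + intros b. destruct (Hunb b) as (n & i & Hn & Hni). exists n.
      split; [|now left]. exists i. split; [|assumption].
      now apply Hnode, HP, HXP.
Qed.

End Stages.

(** * From statements (2), (3) and (6) to arithmetical comprehension *)

Section Reversals.

Context {M : L2structure} {hM : RCA0 M}.

Lemma strong_antichains_bounded_ACA0 : strong_antichains_bounded M -> ACA0 M.
Proof.
  intros H. apply sigma1_comprehension_ACA0, ranges_sigma1_comprehension.
  intros f Df f_inj. now apply strong_antichains_bounded_range.
Qed.

Lemma bounded_strong_antichains_ideals_ACA0 :
  bounded_strong_antichains_ideals M -> ACA0 M.
Proof.
  intros H. apply sigma1_comprehension_ACA0, ranges_sigma1_comprehension.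
  intros f Df f_inj. destruct (ladder_exists f Df) as (P & R & L).
  apply (ladder_ideals_range f Df f_inj P R L), H.
  - now apply (ladder_partial_order f f_inj).
  - now apply (ladder_strong_antichains_bounded f).
Qed.

(** The ladder yields the range of [f] either way: by a decomposition into ideals if it is a
    well-partial order, and by a bad sequence otherwise. *)
Lemma wpo_ideals_ACA0 : wpo_ideals M -> ACA0 M.
Proof.
  intros H. apply sigma1_comprehension_ACA0, ranges_sigma1_comprehension.
  intros f Df f_inj. destruct (ladder_exists f Df) as (P & R & L).
  destruct (classic (well_partial_order P R)) as [W|W].
  - now apply (ladder_ideals_range f Df f_inj P R L), H.
  - now apply (ladder_not_wpo_range f Df f_inj P R L).
Qed.

End Reversals.

Theorem theorem4p5 (M : L2structure) (hM : RCA0 M) :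
  pairwise_equivalent
    [ ACA0 M;
      bounded_strong_antichains_ideals M;
      strong_antichains_bounded M;
      no_infinite_strong_antichain_ideals M;
      initial_intervals_ideals M;
      wpo_ideals M ].
Proof.
  (* These implications connect all six statements: (1) to (4), (4) to (2), (3) and (5), (5) to (6),
     and from (2), (3) and (6) back to (1). *)
  pose proof ACA0_ideals as H14.
  pose proof ideals_bounded_strong_antichains_ideals as H42.
  pose proof ideals_strong_antichains_bounded as H43.
  pose proof ideals_initial_intervals_ideals as H45.
  pose proof initial_intervals_wpo_ideals as H56.
  pose proof bounded_strong_antichains_ideals_ACA0 as H21.
  pose proof strong_antichains_bounded_ACA0 as H31.
  pose proof wpo_ideals_ACA0 as H61.
  intros A B HA HB. simpl in HA, HB.
  destruct HA as [<-|[<-|[<-|[<-|[<-|[<-|[]]]]]]],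
    HB as [<-|[<-|[<-|[<-|[<-|[<-|[]]]]]]]; tauto.
Qed.
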